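(* Let $f:\mathbb{N}_0\to(0,\infty)$ be non-decreasing with $\Phi_2(\infty)<\infty$, and let $\{m_i\}_{i\ge1}$ be an i.i.d. sequence of random variables supported on $\mathbb{N}$. Let $\{\mathcal{G}_n\}_{n\ge0}$ be the random graph sequence with attachment function $f$ and attachment sequence $\{m_i\}_{i\ge1}$. (i) Suppose there exists $C_f>0$ such that $f(i)\le C_f(i+1)$ for all $i\ge0$. If there exist positive constants $D,z_0$ and $\theta>1$ such that $$\mathbb{P}(\Phi_1(m_1)>z)\le e^{-Dz^{\theta}},\quad z\ge z_0,$$ then almost surely a persistent hub emerges. (ii) Suppose $\mathbb{E}(m_1)<\infty$. If there exist positive constants $D',z_0'$ and $\theta'\in(0,1)$ such that $$\mathbb{P}(\Phi_1(m_1)>z)\ge e^{-D'z^{\theta'}},\quad z\ge z_0',$$ then, almost surely, there is no persistent hub.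
   Context: $\mathbb{N}=\{1,2,\dots\}$, $\mathbb{N}_0=\mathbb{N}\cup\{0\}$. For $k=1,2$ and $l\in\mathbb{N}_0$, $\Phi_k(l)=\sum_{i=0}^{l-1}f(i)^{-k}$, and $\Phi_k(\infty)=\lim_{l\to\infty}\Phi_k(l)$. Standing assumptions on attachment functions: $\inf_{i\ge0}f(i)>0$ and $\sum_{i\ge0}1/f(i)=\infty$. Model. Conditionally on a realization of $\{m_i\}_{i\ge1}$, the random graphs $\mathcal{G}_n$ are built as follows. $\mathcal{G}_0$ consists of one vertex $v_0$ and no edges. Given $\mathcal{G}_{n-1}$ (with vertices $v_0,\dots,v_{n-1}$), $\mathcal{G}_n$ is obtained by adding one vertex $v_n$ and $m_n$ edges directed away from $v_n$; the other ends of these edges are attached sequentially, each one to a vertex $v_i$, $0\le i\le n-1$, chosen with (conditional) probability $f(\deg v_i)/\sum_{j=0}^{n-1}f(\deg v_j)$, where degrees are computed immediately before that edge is attached (so they account for the edges of $v_n$ already attached). Multiple edges are allowed. Degree means in-degree plus out-degree. There is a persistent hub if there is a (random) finite $n_0\in\mathbb{N}_0$ such that the same vertex has maximal degree in $\mathcal{G}_n$ for all $n\ge n_0$. *)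

(* Defs.v *)
From HB Require Import structures.
From mathcomp Require Import all_boot all_order all_algebra.
From mathcomp Require Import all_classical all_reals all_analysis.

Set Implicit Arguments.
Unset Strict Implicit.
Unset Printing Implicit Defensive.

Import Order.TTheory GRing.Theory Num.Theory.
Import numFieldNormedType.Exports.

Local Open Scope classical_set_scope.
Local Open Scope ring_scope.

Section attachment_function.
Context {R : realType}.
Implicit Types (f : nat -> R) (k l : nat).

Definition Phi f k l : R := \sum_(0 <= i < l) f i ^- k.

Definition Phi_infty f k : \bar R := limn (fun l => (Phi f k l)%:E).

Definition attachment_function f : Prop :=
  [/\ forall i, 0 < f i, 0 < inf (range f) & Phi_infty f 1 = +oo%E].

End attachment_function.

(* Vertex v_i is the number i. The pair (v, u) is an edge directed from v to u.
   The edges are listed in their order of arrival. *)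
Record multigraph := Multigraph {
  vertices : seq nat;
  edges : seq (nat * nat)
}.

(* in-degree plus out-degree *)
Definition deg (G : multigraph) (v : nat) : nat :=
  (count (fun e => e.2 == v) (edges G) + count (fun e => e.1 == v) (edges G))%N.

Definition add_vertex (v : nat) (G : multigraph) : multigraph :=
  Multigraph (rcons (vertices G) v) (edges G).

Definition add_edge (v u : nat) (G : multigraph) : multigraph :=
  Multigraph (vertices G) (rcons (edges G) (v, u)).

(* k edges from v to u 0, ..., u k.-1, in this order *)
Fixpoint add_edges (v : nat) (u : nat -> nat) (k : nat) (G : multigraph) :
    multigraph :=
  if k is k'.+1 then add_edge v (u k') (add_edges v u k' G) else G.

(* m n is the number of edges of v_n, for 1 <= n, and t n k is the endpoint of
   its edge number k, for k < m n. The values m 0, t 0 k, and t n k for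
   m n <= k play no role. *)
Fixpoint graph (m : nat -> nat) (t : nat -> nat -> nat) (n : nat) : multigraph :=
  if n is n'.+1 then add_edges n (t n) (m n) (add_vertex n (graph m t n'))
  else Multigraph [:: 0%N] [::].

(* The graph obtained from G_n after the arrival of v_{n+1} and of its first k
   edges. *)
Definition partial_graph (m : nat -> nat) (t : nat -> nat -> nat) (n k : nat) :
    multigraph :=
  add_edges n.+1 (t n.+1) k (add_vertex n.+1 (graph m t n)).

Definition has_max_degree (G : multigraph) (v : nat) : Prop :=
  v \in vertices G /\ forall u, u \in vertices G -> (deg G u <= deg G v)%N.

Definition persistent_hub (G : nat -> multigraph) : Prop :=
  exists n0 v, forall n, (n0 <= n)%N -> has_max_degree (G n) v.

Section process.
Context {d : measure_display} {T : measurableType d} {R : realType}.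
Variable P : probability T R.

(* The sequences of the model are indexed by the positive integers, hence the
   conditions on the indices. *)
Definition independent_sequence (X : nat -> {RV P >-> nat}) : Prop :=
  forall (s : seq nat) (B : nat -> set nat), uniq s -> all (leq 1) s ->
    P (\bigcap_(i in [set` s]) X i @^-1` B i) =
    (\prod_(i <- s) P (X i @^-1` B i))%E.

Definition identically_distributed (X : nat -> {RV P >-> nat}) : Prop :=
  forall i j, (0 < i)%N -> (0 < j)%N ->
    distribution P (X i) = distribution P (X j) :> (set nat -> \bar R).

Definition iid (X : nat -> {RV P >-> nat}) : Prop :=
  independent_sequence X /\ identically_distributed X.

(* q is, on the event D of the sigma-algebra F, a version of the conditional
   probability of E given F. *)
Definition conditional_probability_on (F : set (set T)) (D E : set T)
    (q : T -> R) : Prop :=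
  (forall B, measurable B -> F (D `&` q @^-1` B)) /\
  (forall A, F A -> A `<=` D -> P (E `&` A) = \int[P]_(w in A) (q w)%:E)%E.

Variables (m : nat -> {RV P >-> nat}) (t : nat -> nat -> {RV P >-> nat}).

Definition random_graph (n : nat) (w : T) : multigraph :=
  graph (fun i => m i w) (fun i k => t i k w) n.

Definition random_partial_graph (n k : nat) (w : T) : multigraph :=
  partial_graph (fun i => m i w) (fun i k => t i k w) n k.

(* The sigma-algebra generated by the whole sequence m_1, m_2, ... and by the
   graph just before edge number k of v_{n+1} is attached. *)
Definition history (n k : nat) : set (set T) :=
  <<s [set A | exists i a, (0 < i)%N /\ A = m i @^-1` [set a]] `|`
      [set A | exists G, A = random_partial_graph n k @^-1` [set G]] >>.

Definition attachment_probability (f : nat -> R) (G : multigraph) (n i : nat)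
    : R :=
  f (deg G i) / \sum_(0 <= j < n.+1) f (deg G j).

Definition attachment_process (f : nat -> R) : Prop :=
  forall n k i, (i <= n)%N ->
    conditional_probability_on (history n k)
      [set w | (k < m n.+1 w)%N]
      [set w | t n.+1 k w = i]
      (fun w => attachment_probability f (random_partial_graph n k w) n i).

End process.

(* Main.v *)
Require Import Defs.
From HB Require Import structures.
From mathcomp Require Import all_boot all_order all_algebra.
From mathcomp Require Import all_classical all_reals all_analysis measurable_realfun.
From mathcomp Require Import zify ring lra.

Set Implicit Arguments.
Unset Strict Implicit.
Unset Printing Implicit Defensive.

Import Order.TTheory GRing.Theory Num.Theory.
Import numFieldNormedType.Exports.

Local Open Scope classical_set_scope.
Local Open Scope ring_scope.

(** Record time by the number [s] of edges that have arrived, and let the clock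
    at time [s] be the sum, over the earlier edges, of the inverses of the total
    weights at their arrivals. If a vertex has degree [k] and the total weight is
    [W], then [Phi f 1] of its degree increases by [1 / f k] with probability
    [f k / W], hence by [1 / W] on average. So [Phi f 1 (degree)] minus the clock
    is a martingale, and its quadratic variation is an increment of [Phi f 2],
    which is bounded. Every old vertex thus has [Phi f 1] of its degree equal to
    the clock up to a random constant, and the question is whether newborn
    vertices, whose initial value is [Phi f 1 (m_n)], can be ahead of the clock.

    All probabilistic estimates follow from one maximal inequality for
    nonnegative supermartingales ([maximal_inequality]). The information at
    time [s], which consists of the numbers of edges of the first vertices and
    of the earlier endpoints, takes countably many values; [drift] checks the
    supermartingale property on each of them. For real [lam], the product of the
    factors [1 + lam / f i] over the degrees [i] passed by a vertex, times
    [expR (- lam * clock)], is such a supermartingale; as the product is at least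
    [expR (lam * Phi f 1 - 2 * lam ^+ 2 * Phi f 2)], the martingale above has
    Gaussian tails, uniformly in time ([fluctuation_le]).

    Light tails. If [f] grows at most linearly, then the clock is at least
    [c * ln n] when [v_n] is born, while the tail bound and Borel-Cantelli give
    [Phi f 1 (m_n) <= c / 2 * ln n] for all large [n]. By the Gaussian tails the
    later fluctuations of [v_n] are at most [c / 4 * ln n] for all large [n], so
    late vertices stay behind [v_0] ([light_tail_late]) and only finitely many
    vertices compete. It remains to see that any two vertices tie only finitely
    often ([tied_unboundedly_null]). For degrees [a] and [b] of two vertices, the
    product of the complex numbers [1 + 'i * theta / f l] over [l < a] and
    [1 - 'i * theta / f l] over [l < b] is a bounded martingale. Started from a
    tie, its value is 1, but at a later tie of high level it is a real number
    which is at least [3 / 2] for a suitable [theta], and optional stopping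
    bounds the probability of such a tie by a constant [kappa < 1]. Since this
    holds from each tie, infinitely many ties have probability 0.

    Heavy tails. As [m_1] has a finite mean, the clock at the birth of [v_n] is
    of order [ln n] with high probability. Among the [4 ^ j] first vertices, each
    has a chance of at least [2 ^- j] to be born with [Phi f 1 (m_i)] above a
    level of order [j `^ (1 / theta')], which is much larger than the clock. By
    independence this happens for infinitely many [j] ([often_good]), and when [j]
    is large, such a vertex is born with a larger degree than a given old
    vertex. *)

(** * The edges in their order of arrival *)

Section timeline.
Variables (m : nat -> nat) (t : nat -> nat -> nat).

(** Edge number [s], in the order of arrival and counted from 0, is edge number
    [(pos s).2] of the vertex [(pos s).1.+1]. *)
Fixpoint pos (s : nat) : nat * nat :=
  if s is s'.+1 then
    let: (n, k) := pos s' in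
    if (k.+1 < m n.+1)%N then (n, k.+1) else (n.+1, 0%N)
  else (0%N, 0%N).

(** The candidates for the endpoint of edge number [s] are
    [0, ..., stage s]. *)
Definition stage s := (pos s).1.

Definition target s := t (stage s).+1 (pos s).2.

Definition degree s v : nat :=
  (\sum_(r < s) ((target r == v) + ((stage r).+1 == v)))%N.

Lemma posS s : pos s.+1 =
  if ((pos s).2.+1 < m (stage s).+1)%N then (stage s, (pos s).2.+1)
  else ((stage s).+1, 0%N).
Proof. by rewrite /= /stage; case: (pos s). Qed.

Lemma stageS s : (stage s <= stage s.+1 <= (stage s).+1)%N.
Proof. by rewrite [stage s.+1]/stage posS; case: ifP => _ /=; rewrite !leqnn ?leqnSn. Qed.

Lemma stage_le s : (stage s <= s)%N.
Proof. by elim: s => // s IH; have := stageS s; lia. Qed.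

Lemma stage_homo r s : (r <= s)%N -> (stage r <= stage s)%N.
Proof.
move=> /subnK <-; elim: (s - r)%N => // k IH.
by apply: (leq_trans IH); rewrite addSn; case/andP: (stageS (k + r)).
Qed.

Lemma pos_lex r s : (r < s)%N -> (stage r < stage s)%N \/
  stage r = stage s /\ ((pos r).2 < (pos s).2)%N.
Proof.
elim: s => // s IH; rewrite ltnS leq_eqVlt => /orP[/eqP->|/IH];
  rewrite ![stage s.+1]/stage posS; case: ifP => _ /=; lia.
Qed.

Lemma pos_inj : injective pos.
Proof.
move=> r s E; have := @pos_lex r s; have := @pos_lex s r.
by rewrite /stage E; lia.
Qed.

Lemma degreeS s v :
  degree s.+1 v = (degree s v + ((target s == v) + ((stage s).+1 == v)))%N.
Proof. by rewrite /degree big_ord_recr. Qed.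

Lemma degree_step s v : (v <= stage s)%N ->
  degree s.+1 v = (degree s v + (target s == v))%N.
Proof.
by move=> vs; rewrite degreeS; case: eqVneq => [E|_]; rewrite ?addn0 //; lia.
Qed.

Lemma degree_homo r s v : (r <= s)%N -> (degree r v <= degree s v)%N.
Proof.
move=> /subnK <-; elim: (s - r)%N => // k IH.
by rewrite addSn degreeS; lia.
Qed.

Lemma sum_pred1_le (N x : nat) : (\sum_(0 <= j < N) (x == j) <= 1)%N.
Proof.
elim: N => [|N IH]; first by rewrite big_geq.
rewrite big_nat_recr //=; case: eqVneq => [->|_]; last by rewrite addn0.
rewrite big_nat big1 // => i /andP[_ iN].
by rewrite gtn_eqF.
Qed.

Lemma sum_degree_le N s : (\sum_(0 <= j < N) degree s j <= 2 * s)%N.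
Proof.
elim: s => [|s IH]; first by rewrite big1 // => i _; rewrite /degree big_ord0.
under eq_bigr do rewrite degreeS.
rewrite big_split /= [X in (_ + X)%N]big_split /=.
have := sum_pred1_le N (target s); have := sum_pred1_le N (stage s).+1.
lia.
Qed.

(** The graph is the list of its earlier edges, which makes the past of the graph
    the same as the past endpoints. Only vertices that have already arrived need
    to have edges, so that this applies to all outcomes that agree so far. *)
Lemma timeline_graph s : (forall i, (0 < i <= s.+1)%N -> (0 < m i)%N) ->
  ((pos s).2 < m (stage s).+1)%N /\
  partial_graph m t (stage s) (pos s).2 =
  Multigraph (iota 0 (stage s).+2)
    (mkseq (fun r => ((stage r).+1, target r)) s).
Proof.
elim: s => [|s IH] mpos; first by split => //=; apply: mpos.
have [|ks Es] := IH; first by move=> i /andP[i0 i1]; apply: mpos; lia.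
have mn i : (i <= (stage s).+2)%N -> (0 < i)%N -> (0 < m i)%N.
  by move=> il i0; apply: mpos; have := stage_le s; lia.
rewrite /stage posS; case: ifPn => /= [km|].
  split => //; move: Es; rewrite /partial_graph /= => ->.
  by rewrite /add_edge /= mkseqS.
rewrite -leqNgt => mk; split; first exact: mn.
have -> : partial_graph m t (stage s).+1 0 =
          add_vertex (stage s).+2 (add_edge (stage s).+1 (target s)
            (partial_graph m t (stage s) (pos s).2)).
  rewrite /partial_graph /=; congr add_vertex.
  by have -> : m (stage s).+1 = (pos s).2.+1 by lia.
rewrite Es /add_vertex /add_edge /=; congr Multigraph.
  by rewrite -cats1 -[[:: _.+2]]/(iota (0 + (stage s).+2) 1) -iotaD addn1.
by rewrite mkseqS.
Qed.

Lemma mkseq_count (F : nat -> nat * nat) (a : pred (nat * nat)) s :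
  count a (mkseq F s) = (\sum_(r < s) a (F r))%N.
Proof.
elim: s => [|s IH]; first by rewrite big_ord0.
by rewrite mkseqS -cats1 count_cat IH big_ord_recr /= addn0.
Qed.

Lemma deg_timeline V s v :
  deg (Multigraph V (mkseq (fun r => ((stage r).+1, target r)) s)) v =
  degree s v.
Proof. by rewrite /deg /= !mkseq_count /degree big_split. Qed.

Hypothesis mpos : forall i, (0 < i)%N -> (0 < m i)%N.

Lemma pos_lt s : ((pos s).2 < m (stage s).+1)%N.
Proof. by have [] := @timeline_graph s; first by move=> i /andP[/mpos]. Qed.

Lemma partial_graph_pos s :
  partial_graph m t (stage s) (pos s).2 =
  Multigraph (iota 0 (stage s).+2)
    (mkseq (fun r => ((stage r).+1, target r)) s).
Proof. by have [] := @timeline_graph s; first by move=> i /andP[/mpos]. Qed.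

Lemma exists_pos n : exists s, pos s = (n, 0%N).
Proof.
elim: n => [|n [s ps]]; first by exists 0%N.
have H k : (k < m n.+1)%N -> pos (k + s) = (n, k).
  by elim: k => [//|k IH] km; rewrite addSn posS /stage IH ?(ltnW km) //= km.
have m0 := mpos (ltn0Sn n).
exists ((m n.+1).-1.+1 + s)%N; rewrite addSn posS /stage H ?prednK //=.
by rewrite ltnn.
Qed.

Lemma deg_partial_graph s v :
  deg (partial_graph m t (stage s) (pos s).2) v = degree s v.
Proof.
by rewrite partial_graph_pos deg_timeline.
Qed.

Lemma deg_graph n s v : pos s = (n, 0%N) -> deg (graph m t n) v = degree s v.
Proof. by move=> ps; rewrite -deg_partial_graph /stage ps. Qed.

Lemma vertices_graph n : vertices (graph m t n) = iota 0 n.+1.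
Proof.
have [s ps] := exists_pos n; have := partial_graph_pos s.
rewrite /partial_graph /stage ps /= => /(congr1 vertices) /=.
rewrite -[1%N :: _]/(iota 1 n.+1) -[0%N :: _]/(iota 0 n.+2).
rewrite -[n.+2]addn1 iotaD cats1 => /eqP.
by rewrite eqseq_rcons => /andP[/eqP].
Qed.

Hypothesis target_le : forall s, (target s <= stage s)%N.

Lemma degree_emitter s : degree s (stage s).+1 = (pos s).2 /\
  forall v, ((stage s).+1 < v)%N -> degree s v = 0%N.
Proof.
elim: s => [|s [IH1 IH2]]; first by split=> [|v _]; rewrite /degree big_ord0.
have := target_le s; have := pos_lt s; rewrite ![stage s.+1]/stage posS.
case: ifPn => /= [km|km] mk ts; split => [|v vs].
- by rewrite degreeS IH1 eqxx; case: eqVneq => ?; lia.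
- by rewrite degreeS IH2 //; do 2 case: eqVneq => ?; lia.
- by rewrite degreeS IH2 //; do 2 case: eqVneq => ?; lia.
- by rewrite degreeS IH2; [do 2 case: eqVneq => ?; lia | lia].
Qed.

Lemma degree_newborn n s : pos s = (n.+1, 0%N) -> degree s n.+1 = m n.+1.
Proof.
case: s => [//|s]; rewrite posS; case: ifPn => // km [sn].
have := pos_lt s; have := target_le s; rewrite -sn degreeS => mk ts.
by rewrite (degree_emitter s).1 eqxx; case: eqVneq => ?; lia.
Qed.

End timeline.

Lemma pos_ext (m m' : nat -> nat) s r :
  (forall i, (0 < i <= s.+1)%N -> m i = m' i) -> (r <= s)%N -> pos m r = pos m' r.
Proof.
move=> a; elim: r => // r IH rs; rewrite !posS /stage IH ?(ltnW rs) // a //.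
by have := stage_le m' r; rewrite /stage; lia.
Qed.

(** * The clock *)

Section clock.
Context {R : realType}.
Variables (f : nat -> R) (m : nat -> nat) (t : nat -> nat -> nat).

Definition weight s : R :=
  \sum_(0 <= j < (stage m s).+1) f (degree m t s j).

(** The clock advances by the expected increment of [Phi f 1] at the degree of
    any given candidate. *)
Definition clock s : R := \sum_(0 <= r < s) (weight r)^-1.

Hypothesis f_gt0 : forall i, 0 < f i.
Hypothesis f_ndecr : forall i j, (i <= j)%N -> f i <= f j.

Lemma clockS s : clock s.+1 = clock s + (weight s)^-1.
Proof. by rewrite /clock big_nat_recr. Qed.

Lemma weight_ge s : (stage m s).+1%:R * f 0 <= weight s.
Proof.
apply: (@le_trans _ _ (\sum_(0 <= j < (stage m s).+1) f 0)).
  by rewrite sumr_const_nat subn0 mulr_natl.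
by apply: ler_sum => i _; exact: f_ndecr.
Qed.

Lemma weight_gt0 s : 0 < weight s.
Proof. by apply: lt_le_trans (weight_ge s); rewrite mulr_gt0. Qed.

Lemma ln_succ_le (s : nat) : ln (s.+2%:R : R) <= ln s.+1%:R + s.+1%:R^-1.
Proof.
have s0 : 0 < s.+1%:R :> R by [].
have -> : s.+2%:R = s.+1%:R * (1 + s.+1%:R^-1) :> R.
  by rewrite mulrDr mulr1 mulfV // -natr1.
have i0 : 0 < s.+1%:R^-1 :> R by rewrite invr_gt0.
rewrite lnM ?posrE ?addr_gt0 // lerD2l le_ln1Dx //.
by apply: lt_trans i0; rewrite ltrN10.
Qed.

(** All degrees add up to at most [2 * s], so that linear growth of [f] keeps
    the total weight of order [s]. *)
Lemma clock_ge (C : R) s : 0 < C -> (forall i, f i <= C * i.+1%:R) ->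
  (3 * C)^-1 * ln s.+1%:R <= clock s.
Proof.
move=> C0 fC; elim: s => [|s IH].
  by rewrite ln1 mulr0 /clock big_geq.
have C3 : 0 < 3 * C by rewrite mulr_gt0.
have wC : weight s <= 3 * C * s.+1%:R.
  rewrite /weight.
  have : \sum_(0 <= j < (stage m s).+1) f (degree m t s j) <=
         \sum_(0 <= j < (stage m s).+1) C * (degree m t s j).+1%:R.
    by apply: ler_sum => i _; exact: fC.
  move=> /le_trans; apply; rewrite -mulr_sumr mulrAC mulrC ler_pM2r //.
  rewrite -natr_sum -natrM ler_nat.
  under eq_bigr do rewrite -addn1.
  rewrite big_split /= sum_nat_const_nat.
  have := sum_degree_le m t (stage m s).+1 s; have := stage_le m s; lia.
rewrite clockS; apply: le_trans (lerD IH (lexx _)).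
apply: (le_trans (ler_wpM2l _ (ln_succ_le s))); first by rewrite invr_ge0 ltW.
rewrite mulrDr lerD2l -invfM lef_pV2 ?posrE ?weight_gt0 //.
by rewrite mulr_gt0.
Qed.

Hypothesis mpos : forall i, (0 < i)%N -> (0 < m i)%N.

(** The weights are at least [f 0 * n.+1] while the edges of [n.+1] arrive. *)
Lemma clock_le s : clock s <=
  (f 0)^-1 * (\sum_(1 <= i < (stage m s).+1) (m i)%:R / i%:R
              + (pos m s).2%:R / (stage m s).+1%:R).
Proof.
elim: s => [|s IH].
  by rewrite /clock !big_geq // mul0r addr0 mulr0.
have step : (weight s)^-1 <= (f 0)^-1 * (stage m s).+1%:R^-1.
  rewrite -invfM lef_pV2 ?posrE ?weight_gt0 // ?mulr_gt0 //.
  by rewrite mulrC weight_ge.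
rewrite clockS; apply: (le_trans (lerD IH step)).
have := pos_lt t mpos s; rewrite -mulrDr ler_pM2l ?invr_gt0 //.
rewrite [stage m s.+1]/stage posS; case: ifPn => /= [km _|km mk].
  by rewrite -addrA -[(pos m s).2.+1%:R]natr1 mulrDl mul1r.
have E : m (stage m s).+1 = (pos m s).2.+1 by lia.
rewrite mul0r addr0 [leRHS]big_nat_recr //= E -[(pos m s).2.+1%:R]natr1 mulrDl mul1r.
by rewrite addrA.
Qed.

Lemma clock_le_start n s : pos m s = (n, 0%N) ->
  clock s <= (f 0)^-1 * \sum_(1 <= i < n.+1) (m i)%:R / i%:R.
Proof.
by move=> ps; have := clock_le s; rewrite /stage ps /= mul0r addr0.
Qed.

End clock.

(** * Products over the degrees *)

Section attachment.
Context {R : realType}.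
Variable f : nat -> R.
Hypothesis f_gt0 : forall i, 0 < f i.
Hypothesis f_ndecr : forall i j, (i <= j)%N -> f i <= f j.
Hypothesis Phi2_finite : (Phi_infty f 2 < +oo)%E.

Local Notation Phi2oo := (fine (Phi_infty f 2)).

Lemma PhiS k l : Phi f k l.+1 = Phi f k l + f l ^- k.
Proof. by rewrite /Phi big_nat_recr. Qed.

Lemma Phi_homo k a b : (a <= b)%N -> Phi f k a <= Phi f k b.
Proof.
move=> /subnK <-; elim: (b - a)%N => // j IH; rewrite addSn PhiS.
by apply: (le_trans IH); rewrite lerDl invr_ge0 exprn_ge0 // ltW.
Qed.

Lemma Phi1_lt a b : Phi f 1 a < Phi f 1 b -> (a < b)%N.
Proof. by rewrite ltnNge; apply: contraTN => /(Phi_homo 1); rewrite -leNgt. Qed.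

Lemma Phi2_cvg : Phi f 2 @ \oo --> Phi2oo.
Proof.
have nd : {homo (fun l => (Phi f 2 l)%:E) : a b / (a <= b)%N >-> (a <= b)%E}.
  by move=> a b ab; rewrite lee_fin Phi_homo.
have /cvg_ex [l cl] : cvgn (fun l => (Phi f 2 l)%:E).
  exact: ereal_nondecreasing_is_cvgn.
have El : Phi_infty f 2 = l by exact/cvg_lim.
have l0 : (0 <= l)%E.
  rewrite -El; apply: lime_ge; first by apply/cvg_ex; exists l.
  by apply: nearW => n; rewrite lee_fin -[0](_ : Phi f 2 0 = 0)
    ?Phi_homo // /Phi big_geq.
have fl : l \is a fin_num by rewrite ge0_fin_numE // -El.
by move: cl; rewrite El -{1}(fineK fl) => /fine_cvgP[_].
Qed.

Lemma Phi2_le l : Phi f 2 l <= Phi2oo.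
Proof.
have c : cvgn (Phi f 2) by apply/cvg_ex; exists Phi2oo; exact: Phi2_cvg.
rewrite -(cvg_lim _ Phi2_cvg) //; apply: nondecreasing_cvgn_le => //.
by move=> a b ab; exact: Phi_homo.
Qed.

Lemma Phi2_ge0 l : 0 <= Phi f 2 l.
Proof. by rewrite -[0](_ : Phi f 2 0 = 0) ?Phi_homo // /Phi big_geq. Qed.

(** The factor [1 + lam / f i] averages, over a step at which a vertex of degree
    [i] gains an edge with probability [f i / W], to [1 + lam / W]. *)
Definition growth lam a b : R := \prod_(a <= i < b) (1 + lam / f i).

Lemma growthS lam a b : (a <= b)%N ->
  growth lam a b.+1 = growth lam a b * (1 + lam / f b).
Proof. by move=> ab; rewrite /growth big_nat_recr. Qed.

Lemma growth_refl lam a : growth lam a a = 1.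
Proof. by rewrite /growth big_geq. Qed.

Lemma expR_quadratic_le (y : R) : - 2^-1 <= y -> expR (y - 2 * y ^+ 2) <= 1 + y.
Proof.
move=> hy; have p : 0 < 1 + (2 * y ^+ 2 - y) by nra.
have -> : y - 2 * y ^+ 2 = - (2 * y ^+ 2 - y) by ring.
rewrite expRN; apply: (@le_trans _ _ (1 + (2 * y ^+ 2 - y))^-1).
  by rewrite lef_pV2 ?posrE ?expR_gt0 // expR_ge1Dx.
rewrite -[leLHS]mul1r ler_pdivrMr //; nra.
Qed.

Lemma lam_div_ge lam i : - (f 0 / 2) <= lam -> - 2^-1 <= lam / f i.
Proof.
move=> hl; rewrite ler_pdivlMr //; apply: le_trans hl.
by rewrite mulNr lerN2 mulrC ler_wpM2l ?invr_ge0 //; exact: f_ndecr.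
Qed.

Lemma growth_ge0 lam a b : - (f 0 / 2) <= lam -> 0 <= growth lam a b.
Proof.
by move=> hl; apply: prodr_ge0 => i _; have := lam_div_ge i hl; lra.
Qed.

Lemma growth_ge lam a b : - (f 0 / 2) <= lam -> (a <= b)%N ->
  expR (lam * (Phi f 1 b - Phi f 1 a) - 2 * lam ^+ 2 * Phi2oo)
    <= growth lam a b.
Proof.
move=> hl ab; apply: (@le_trans _ _ (expR (lam * (Phi f 1 b - Phi f 1 a)
    - 2 * lam ^+ 2 * (Phi f 2 b - Phi f 2 a)))).
  rewrite ler_expR lerD2l lerN2; apply: ler_wpM2l.
    by rewrite mulr_ge0 // sqr_ge0.
  by have := Phi2_le b; have := Phi2_ge0 a; lra.
move: ab => /subnK <-; elim: (b - a)%N => [|j IH].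
  by rewrite add0n growth_refl !subrr !mulr0 subrr expR0.
rewrite addSn growthS ?leq_addl // !PhiS.
have y0 := lam_div_ge (j + a) hl; have := expR_quadratic_le y0.
set y := lam / f (j + a)%N => hy.
have -> : lam * (Phi f 1 (j + a) + f (j + a)%N ^- 1 - Phi f 1 a) -
  2 * lam ^+ 2 * (Phi f 2 (j + a) + f (j + a)%N ^- 2 - Phi f 2 a) =
  lam * (Phi f 1 (j + a) - Phi f 1 a) -
  2 * lam ^+ 2 * (Phi f 2 (j + a) - Phi f 2 a) + (y - 2 * y ^+ 2).
  by rewrite /y expr1 exprMn exprVn; ring.
by rewrite expRD; apply: ler_pM; rewrite ?expR_ge0.
Qed.

(** The real and imaginary parts of
    [\prod_(k <= l < k + j) (1 + 'i * theta / f l)]. *)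
Fixpoint turn theta k j : R * R :=
  if j is j'.+1 then
    let x := theta / f (k + j')%N in
    let: (c, s) := turn theta k j' in (c - x * s, s + x * c)
  else (1, 0).

Definition turn_norm2 theta k j : R :=
  (turn theta k j).1 ^+ 2 + (turn theta k j).2 ^+ 2.

(** The real part of the turn from [k] to [a] times the conjugate of the turn
    from [k] to [b]. *)
Definition alignment theta k a b : R :=
  (turn theta k (a - k)).1 * (turn theta k (b - k)).1 +
  (turn theta k (a - k)).2 * (turn theta k (b - k)).2.

Lemma turnS theta k j : turn theta k j.+1 =
  ((turn theta k j).1 - theta / f (k + j)%N * (turn theta k j).2,
   (turn theta k j).2 + theta / f (k + j)%N * (turn theta k j).1).
Proof. by rewrite /=; case: turn. Qed.

Lemma turn_norm2S theta k j : turn_norm2 theta k j.+1 =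
  turn_norm2 theta k j * (1 + theta ^+ 2 * f (k + j)%N ^- 2).
Proof. by rewrite /turn_norm2 turnS /= -exprVn; ring. Qed.

(** If the degrees [a] and [b] increase at the rates [f a] and [f b], then they
    turn the product in opposite directions at the same speed [theta]. *)
Lemma alignment_harmonic theta k a b : (k <= a)%N -> (k <= b)%N ->
  f a * (alignment theta k a.+1 b - alignment theta k a b) +
  f b * (alignment theta k a b.+1 - alignment theta k a b) = 0.
Proof.
move=> ka kb; rewrite /alignment !subSn // !turnS !subnKC //=.
by field; rewrite !gt_eqF.
Qed.

Lemma alignment_ge theta k a b :
  - ((turn_norm2 theta k (a - k) + turn_norm2 theta k (b - k)) / 2)
    <= alignment theta k a b.
Proof.
rewrite /alignment /turn_norm2.
set x := (_).1; set y := (_).2; set z := (_).1; set u := (_).2.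
have := sqr_ge0 (x + z); have := sqr_ge0 (y + u); rewrite !sqrrD; lra.
Qed.

Lemma alignment_diag theta k a :
  alignment theta k a a = turn_norm2 theta k (a - k).
Proof. by rewrite /alignment /turn_norm2 !expr2. Qed.

Lemma turn_norm2_le theta k j :
  turn_norm2 theta k j <= expR (theta ^+ 2 * (Phi f 2 (k + j) - Phi f 2 k)).
Proof.
elim: j => [|j IH].
  by rewrite addn0 subrr mulr0 expR0 /turn_norm2 /= expr1n expr0n addr0.
rewrite turn_norm2S addnS PhiS.
rewrite (_ : _ + _ - _ = Phi f 2 (k + j) - Phi f 2 k + f (k + j)%N ^- 2);
  last by ring.
rewrite [X in expR X]mulrDr expRD; apply: ler_pM => //.
- by rewrite /turn_norm2 addr_ge0 ?sqr_ge0.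
- by rewrite addr_ge0 // mulr_ge0 ?sqr_ge0 // invr_ge0 sqr_ge0.
- exact: expR_ge1Dx.
Qed.

Lemma turn_norm2_ge theta k j :
  1 + theta ^+ 2 * (Phi f 2 (k + j) - Phi f 2 k) <= turn_norm2 theta k j.
Proof.
elim: j => [|j IH].
  by rewrite addn0 subrr mulr0 addr0 /turn_norm2 /= expr1n expr0n addr0.
rewrite turn_norm2S addnS PhiS.
have x0 : 0 <= theta ^+ 2 * f (k + j)%N ^- 2.
  by rewrite mulr_ge0 ?sqr_ge0 // invr_ge0 sqr_ge0.
have y0 : 0 <= theta ^+ 2 * (Phi f 2 (k + j) - Phi f 2 k).
  by rewrite mulr_ge0 ?sqr_ge0 // subr_ge0 Phi_homo // leq_addr.
move: IH x0 y0; rewrite !mulrDr.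
set x := (_ * f _ ^- 2); set N := turn_norm2 _ _ _; nra.
Qed.

Lemma Phi2_lt k : Phi f 2 k < Phi2oo.
Proof.
by apply: lt_le_trans (Phi2_le k.+1); rewrite PhiS ltrDl invr_gt0 exprn_gt0.
Qed.

(** The squares of [tie_angle k / f l], for [k <= l], add up to 1. *)
Definition tie_angle k : R := (Num.sqrt (Phi2oo - Phi f 2 k))^-1.

Definition tie_potential k a b : R := alignment (tie_angle k) k a b.

Lemma tie_angle2 k : tie_angle k ^+ 2 = (Phi2oo - Phi f 2 k)^-1.
Proof. by rewrite /tie_angle exprVn sqr_sqrtr // subr_ge0 Phi2_le. Qed.

Lemma tie_potential_start k : tie_potential k k k = 1.
Proof.
by rewrite /tie_potential alignment_diag subnn /turn_norm2 /= expr1n expr0n addr0.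
Qed.

Lemma tie_potential_ge k a b : (k <= a)%N -> (k <= b)%N ->
  - expR 1 <= tie_potential k a b.
Proof.
move=> ka kb; apply: le_trans (alignment_ge _ _ _ _).
have H c : (k <= c)%N -> turn_norm2 (tie_angle k) k (c - k) <= expR 1.
  move=> kc; apply: (le_trans (turn_norm2_le _ _ _)).
  rewrite tie_angle2 subnKC // ler_expR mulrC ler_pdivrMr ?subr_gt0 ?Phi2_lt //.
  by rewrite mul1r lerD2r Phi2_le.
by have := H _ ka; have := H _ kb; lra.
Qed.

Lemma tie_potential_far k :
  exists K, forall l, (K <= l)%N -> (k <= l)%N -> 3 / 2 <= tie_potential k l l.
Proof.
have r0 : 0 < Phi2oo - Phi f 2 k by rewrite subr_gt0 Phi2_lt.
have : \forall l \near \oo, (Phi2oo + Phi f 2 k) / 2 < Phi f 2 l.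
  by apply: cvgr_gt Phi2_cvg _ _; have := Phi2_lt k; lra.
move=> [K _ HK]; exists K => l Kl kl.
rewrite /tie_potential alignment_diag.
apply: le_trans (turn_norm2_ge _ _ _); rewrite tie_angle2 subnKC //.
have := HK l Kl; rewrite /= => h.
have : 2^-1 <= (Phi2oo - Phi f 2 k)^-1 * (Phi f 2 l - Phi f 2 k).
  by rewrite [leRHS]mulrC ler_pdivlMr //; lra.
lra.
Qed.

End attachment.

(** * A maximal inequality *)

Section maximal_inequality.
Context d (T : measurableType d) (R : realType) (P : probability T R).
Variables (F : nat -> set (set T)) (Z : nat -> T -> R) (s : nat) (l : R).

Hypothesis l_gt0 : 0 < l.
Hypothesis F_measurable : forall r A, (s <= r)%N -> F r A -> measurable A.
Hypothesis F_homo : forall r A, (s <= r)%N -> F r A -> F r.+1 A.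
Hypothesis F_cut : forall r A, (s <= r)%N -> F r A ->
  F r (A `&` [set w | Z r w < l]).
Hypothesis Z_measurable : forall r, (s <= r)%N -> measurable_fun setT (Z r).
Hypothesis Z_ge0 : forall r A w, (s <= r)%N -> F r A -> A w -> 0 <= Z r w.
Hypothesis Z_drift : forall r A, (s <= r)%N -> F r A ->
  (\int[P]_(w in A) (Z r.+1 w)%:E <= \int[P]_(w in A) (Z r w)%:E)%E.

Let within h r := [set w | exists2 i, (i <= h)%N & l <= Z (r + i)%N w].

Let ge_measurable r : (s <= r)%N -> measurable [set w | l <= Z r w].
Proof.
move=> sr; have -> : [set w | l <= Z r w] = Z r @^-1` `[l, +oo[.
  by apply/seteqP; split => w /=; rewrite in_itv /= andbT.
by rewrite -[X in measurable X]setTI; apply: Z_measurable.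
Qed.

Let withinE h r : within h r =
  \bigcup_(i in [set i | (i <= h)%N]) [set w | l <= Z (r + i)%N w].
Proof. by apply/seteqP; split => w [i]; exists i. Qed.

Let within_measurable h r : (s <= r)%N -> measurable (within h r).
Proof.
move=> sr; rewrite withinE; apply: bigcup_measurable => i _.
by apply: ge_measurable; rewrite (leq_trans sr) // leq_addr.
Qed.

Let EFin_measurable A r : (s <= r)%N ->
  measurable_fun A (EFin \o Z r).
Proof.
move=> sr; apply: (measurable_funS measurableT) => //.
by apply/measurable_EFinP; apply: Z_measurable.
Qed.

Let within_le h r A : (s <= r)%N -> F r A ->
  (l%:E * P (A `&` within h r) <= \int[P]_(w in A) (Z r w)%:E)%E.
Proof.
elim: h r A => [|h IH] r A sr FA; have mA := F_measurable sr FA;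
  have mge := ge_measurable sr.
- have -> : within 0 r = [set w | l <= Z r w].
    apply/seteqP; split => w /=; last by exists 0%N; rewrite ?addn0.
    by case=> i; rewrite leqn0 => /eqP ->; rewrite addn0.
  set G := [set w | l <= Z r w] in mge *.
  have mAge : measurable (A `&` G) by exact: measurableI.
  apply: (@le_trans _ _ (\int[P]_(w in A `&` G) (Z r w)%:E)%E).
    rewrite -integral_cst //; apply: ge0_le_integral => //.
    + by move=> w _; rewrite lee_fin ltW.
    + exact: EFin_measurable.
    + by move=> w [_ /=]; rewrite lee_fin.
  apply: ge0_subset_integral => //; first exact: EFin_measurable.
  by move=> w Aw; rewrite lee_fin (Z_ge0 sr FA).
- set A1 := A `&` [set w | l <= Z r w].
  set A2 := A `&` [set w | Z r w < l].
  have FA2 : F r A2 by exact: F_cut.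
  have mA1 : measurable A1 by exact: measurableI.
  have mA2 : measurable A2 by exact: F_measurable FA2.
  have mw := within_measurable h (leqW sr).
  have AE : A = A1 `|` A2.
    apply/seteqP; split => [w Aw|w [[]|[]]] //.
    by have [|] := leP l (Z r w); [left|right].
  have sub : A `&` within h.+1 r `<=` A1 `|` (A2 `&` within h r.+1).
    move=> w [Aw [i ih lZ]]; have [le|lt] := leP l (Z r w); [left|right] => //.
    split => //; case: i ih lZ => [|i] ih lZ.
      by move: lZ; rewrite addn0 leNgt lt.
    by exists i => //; rewrite addSnnS.
  have mI : measurable (A2 `&` within h r.+1) by exact: measurableI.
  have mh : measurable (A `&` within h.+1 r).
    by apply: measurableI => //; exact: within_measurable.
  apply: (@le_trans _ _ (l%:E * (P A1 + P (A2 `&` within h r.+1)))%E).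
    apply: lee_wpmul2l; first by rewrite lee_fin ltW.
    apply: (@le_trans _ _ (P (A1 `|` (A2 `&` within h r.+1)))).
      by apply: le_measure; rewrite ?inE //; exact: measurableU.
    exact: measureU2.
  rewrite [in leRHS]AE ge0_integral_setU //; first last.
  + by apply/disj_setPS => w [[_ /= le] [_ /= ]]; rewrite ltNge le.
  + by move=> w; rewrite -AE => Aw; rewrite lee_fin (Z_ge0 sr FA).
  + exact: EFin_measurable.
  rewrite muleDr ?ge0_adde_def ?inE //; apply: leeD.
    rewrite -integral_cst //; apply: ge0_le_integral => //.
    + by move=> w _; rewrite lee_fin ltW.
    + exact: EFin_measurable.
    + by move=> w [_ /=]; rewrite lee_fin.
  apply: le_trans (Z_drift sr FA2).
  by apply: IH; [exact: leqW | exact: F_homo].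
Qed.

(** A nonnegative supermartingale that starts at [z] reaches the level [l] with
    probability at most [z / l]: it still carries the mass [l] on the event that
    it does so, if it is stopped there. *)
Lemma maximal_inequality A z : F s A -> (forall w, A w -> Z s w = z) ->
  (P (A `&` [set w | exists2 r, (s <= r)%N & (l <= Z r w)%R])
    <= (z / l)%:E * P A)%E.
Proof.
move=> FA Zz; have mA := F_measurable (leqnn s) FA.
set B := [set w | _].
have BE : A `&` B = \bigcup_h (A `&` within h s).
  apply/seteqP; split => [w [Aw [r sr lZ]]|w [h _ [Aw [i _ lZ]]]].
    by exists (r - s)%N => //; split => //; exists (r - s)%N; rewrite ?subnKC.
  by split => //; exists (s + i)%N; rewrite ?leq_addr.
have mAw h : measurable (A `&` within h s).
  by apply: measurableI => //; exact: within_measurable.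
have c := @nondecreasing_cvg_mu _ _ _ P (fun h => A `&` within h s) mAw
  (bigcup_measurable (fun k _ => mAw k)).
rewrite BE -(cvg_lim _ (c _)) //; last first.
  move=> a b ab; apply/subsetPset => w [Aw [i ia lZ]]; split => //.
  by exists i => //; exact: leq_trans ab.
apply: lime_le.
  apply/cvg_ex; eexists; apply: c.
  move=> a b ab; apply/subsetPset => w [Aw [i ia lZ]]; split => //.
  by exists i => //; exact: leq_trans ab.
apply: nearW => h /=; rewrite mulrC EFinM -muleA.
rewrite -(@lee_pmul2l _ l%:E) // muleA -EFinM mulfV ?gt_eqF // mul1e.
apply: (le_trans (within_le h (leqnn s) FA)).
rewrite (eq_integral (cst z%:E)) ?integral_cst //.
by move=> w; rewrite inE => Aw; rewrite Zz.
Qed.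

End maximal_inequality.

(** * The events of the past *)

Section process.
Context d (T : measurableType d) (R : realType) (P : probability T R).
Variables (m : nat -> {RV P >-> nat}) (t : nat -> nat -> {RV P >-> nat}).

Local Notation ms w := (fun i => m i w).
Local Notation ts w := (fun i k => t i k w).

(** The two outcomes agree on the graph just before edge number [s] and on the
    numbers of edges [m_1, ..., m_(s+1)], which determine when the first [s.+1]
    edges arrive. These relations cut the sample space into countably many
    atoms, so that conditioning on the past is elementary. *)
Definition agree s w w' : Prop :=
  (forall i, (0 < i <= s.+1)%N -> m i w = m i w') /\
  (forall r, (r < s)%N -> target (ms w) (ts w) r = target (ms w') (ts w') r).

Definition determined s (Y : Type) (X : T -> Y) : Prop :=
  forall w w', agree s w w' -> X w = X w'.

Lemma agree_homo r s w w' : (r <= s)%N -> agree s w w' -> agree r w w'.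
Proof.
by move=> rs [a b]; split => [i ir|i ir]; [apply: a|apply: b]; lia.
Qed.

Lemma agree_sym s w w' : agree s w w' -> agree s w' w.
Proof. by move=> [a b]; split => i h; rewrite ?a ?b. Qed.

Lemma agree_trans s w w' w'' : agree s w w' -> agree s w' w'' -> agree s w w''.
Proof. by move=> [a b] [a' b']; split => i h; rewrite ?a ?b // ?a' ?b'. Qed.

Lemma determined_homo r s Y (X : T -> Y) : (r <= s)%N ->
  determined r X -> determined s X.
Proof. by move=> rs hX w w' /(agree_homo rs)/hX. Qed.

Lemma determined_comp s Y Y' (X : T -> Y) (g : Y -> Y') :
  determined s X -> determined s (fun w => g (X w)).
Proof. by move=> hX w w' /hX ->. Qed.

Lemma determined_pair s Y Y' Y'' (X : T -> Y) (X' : T -> Y')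
    (g : Y -> Y' -> Y'') :
  determined s X -> determined s X' -> determined s (fun w => g (X w) (X' w)).
Proof. by move=> hX hX' w w' a; rewrite (hX _ _ a) (hX' _ _ a). Qed.

Lemma determined_setI s (A B : set T) :
  determined s A -> determined s B -> determined s (A `&` B).
Proof. exact: determined_pair. Qed.

Lemma determined_pos r s : (r <= s)%N -> determined s (fun w => pos (ms w) r).
Proof.
by move=> rs w w' [a _]; exact: pos_ext rs.
Qed.

Lemma determined_stage r s : (r <= s)%N ->
  determined s (fun w => stage (ms w) r).
Proof. by move=> /determined_pos; apply: determined_comp. Qed.

Lemma determined_target r s : (r < s)%N ->
  determined s (fun w => target (ms w) (ts w) r).
Proof. by move=> rs w w' [_]; apply. Qed.

Lemma determined_degree r s v : (r <= s)%N ->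
  determined s (fun w => degree (ms w) (ts w) r v).
Proof.
move=> rs w w' a; apply: eq_bigr => q _; congr (_ + _)%N.
  by rewrite (@determined_target q s (leq_trans (ltn_ord q) rs) _ _ a).
have qs : (q <= s)%N by rewrite (leq_trans _ rs) // ltnW.
by rewrite (determined_stage qs a).
Qed.

Lemma determined_weight (f : nat -> R) r s : (r <= s)%N ->
  determined s (fun w => weight f (ms w) (ts w) r).
Proof.
move=> rs w w' a; rewrite /weight (determined_stage rs a).
by apply: eq_bigr => j _; rewrite (determined_degree j rs a).
Qed.

Lemma determined_clock (f : nat -> R) r s : (r <= s.+1)%N ->
  determined s (fun w => clock f (ms w) (ts w) r).
Proof.
move=> rs w w' a; rewrite /clock big_nat [RHS]big_nat.
apply: eq_bigr => q /andP[_ qr]; congr (_^-1).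
by apply: determined_weight a; lia.
Qed.

Definition past_code s w : nat :=
  pickle (mkseq (fun i => m i.+1 w) s.+1,
          mkseq (fun r => target (ms w) (ts w) r) s).

Lemma past_codeP s w w' : past_code s w = past_code s w' <-> agree s w w'.
Proof.
split => [/(pcan_inj pickleK) E|[a b]].
  have E1 := congr1 fst E; have E2 := congr1 snd E.
  split => [[//|i] /andP[_ i1]|r rs].
    by have := congr1 (fun x => nth 0%N x i) E1; rewrite /= -!/(mkseq _ s.+1) !nth_mkseq.
  by have := congr1 (fun x => nth 0%N x r) E2; rewrite /= !nth_mkseq.
rewrite /past_code; congr (pickle (_, _)); apply/eq_in_map => i.
  by rewrite mem_iota => h; apply: a; lia.
by rewrite mem_iota => h; apply: b; lia.
Qed.

Lemma nat_event (X : {RV P >-> nat}) (B : set nat) : measurable (X @^-1` B).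
Proof. exact: measurable_funPTI. Qed.

Lemma agreeE s w0 : [set w | agree s w0 w] =
  (\bigcap_(i in [set i | (0 < i <= s.+1)%N]) (m i @^-1` [set m i w0])) `&`
  \bigcap_(r in [set r | (r < s)%N])
    (t (stage (ms w0) r).+1 (pos (ms w0) r).2
       @^-1` [set target (ms w0) (ts w0) r]).
Proof.
apply/seteqP; split => w [a b]; split => [i hi|r hr].
- by rewrite /= a.
- by rewrite /= (b r hr) /target /stage (pos_ext a (ltnW hr)).
- by rewrite -(a i hi).
- rewrite -(b r hr) /target /stage (@pos_ext _ (ms w) s r _ (ltnW hr)) //.
  by move=> i hi; rewrite -(a i hi).
Qed.

Lemma agree_measurable s w0 : measurable [set w | agree s w0 w].
Proof.
rewrite agreeE; apply: measurableI; apply: bigcap_measurableType => i _;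
  exact: nat_event.
Qed.

(** As the graph lists its edges, the atoms are events of the history on which
    the attachment probabilities are conditioned. *)
Lemma agree_history s w0 : (forall i, (0 < i <= s.+1)%N -> (0 < m i w0)%N) ->
  history m t (stage (ms w0) s) (pos (ms w0) s).2 [set w | agree s w0 w].
Proof.
move=> mpos; set n := stage _ _; set k := (_).2.
have -> : [set w | agree s w0 w] =
    (\bigcap_(i in [set i | (0 < i <= s.+1)%N]) (m i @^-1` [set m i w0])) `&`
    (random_partial_graph m t n k @^-1` [set random_partial_graph m t n k w0]).
  have graphE w : (forall i, (0 < i <= s.+1)%N -> m i w0 = m i w) ->
      random_partial_graph m t n k w = Multigraph (iota 0 n.+2)
        (mkseq (fun r => ((stage (ms w) r).+1, target (ms w) (ts w) r)) s).
    move=> a; have [i hi|_] := @timeline_graph (ms w) (ts w) s.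
      by rewrite -a //; exact: mpos.
    by rewrite /n /k /stage (pos_ext a (leqnn s)).
  apply/seteqP; split => w.
    move=> a; split => [i hi|]; first by rewrite /= a.1.
    rewrite /= !graphE //; last exact: a.1.
    congr Multigraph; apply/eq_in_map => r; rewrite mem_iota => /andP[_ rs].
    have rs' : (r <= s)%N by rewrite ltnW.
    by rewrite (determined_stage rs' a) (a.2 _ rs).
  move=> [a /=]; have a' i : (0 < i <= s.+1)%N -> m i w0 = m i w.
    by move=> hi; rewrite -(a i hi).
  rewrite !graphE // => -[E]; split => // r rs.
  by have := congr1 (fun x => nth (0%N, 0%N) x r) E; rewrite !nth_mkseq // => -[].
rewrite /history; set G := (X in <<s X >>).
have mI := @measurableI _ (g_sigma_algebraType G).
apply: mI.
  apply: (@bigcap_measurableType _ (g_sigma_algebraType G)) => i /= /andP[i0 _].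
  by apply: sub_sigma_algebra; left; exists i, (m i w0).
by apply: sub_sigma_algebra; right; eexists.
Qed.

Lemma determined_atom s (A : set T) w0 : determined s A -> A w0 ->
  A `&` [set w | past_code s w = past_code s w0] = [set w | agree s w0 w].
Proof.
move=> hA Aw0; apply/seteqP; split => w /=.
  by move=> [_ /past_codeP/agree_sym].
by move=> a; split; [rewrite -(hA _ _ a)|apply/past_codeP/agree_sym].
Qed.

Lemma determined_measurable s (A : set T) : determined s A -> measurable A.
Proof.
move=> hA.
have -> : A = \bigcup_c (A `&` [set w | past_code s w = c]).
  apply/seteqP; split => [w Aw|w [c _ []]//].
  by exists (past_code s w).
apply: bigcup_measurable => c _.
have [[w [Aw <-]]|N] := pselect (exists w, A w /\ past_code s w = c).
  by rewrite determined_atom //; exact: agree_measurable.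
rewrite (_ : _ `&` _ = set0) //; apply/seteqP; split => // w [Aw cw].
by apply: N; exists w.
Qed.

Lemma determined_measurable_fun s (X : T -> R) :
  determined s X -> measurable_fun setT X.
Proof.
move=> hX _ B _; rewrite setTI; apply: (@determined_measurable s).
exact: determined_comp.
Qed.

End process.

(** * One step of the process *)

Section one_step.
Context d (T : measurableType d) (R : realType) (P : probability T R).
Variables (f : nat -> R) (m : nat -> {RV P >-> nat})
  (t : nat -> nat -> {RV P >-> nat}).
Hypothesis f_gt0 : forall i, 0 < f i.
Hypothesis f_ndecr : forall i j, (i <= j)%N -> f i <= f j.
Hypothesis m_pos : forall i, (0 < i)%N -> {ae P, forall w, (0 < m i w)%N}.
Hypothesis G_process : attachment_process m t f.

Local Notation ms w := (fun i => m i w).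
Local Notation ts w := (fun i k => t i k w).

Let chance s w i : R :=
  f (degree (ms w) (ts w) s i) / weight f (ms w) (ts w) s.

Lemma sum_chance s w :
  \sum_(i <- iota 0 (stage (ms w) s).+1) chance s w i = 1.
Proof.
have := weight_gt0 (ms w) (ts w) f_gt0 f_ndecr s.
rewrite /chance -mulr_suml /weight /index_iota subn0 => h.
by rewrite divff // gt_eqF.
Qed.

Lemma atom_target s w0 i :
  (forall i, (0 < i <= s.+1)%N -> (0 < m i w0)%N) ->
  (i <= stage (ms w0) s)%N ->
  (P ([set w | agree m t s w0 w] `&` [set w | target (ms w) (ts w) s = i]) =
   (chance s w0 i)%:E * P [set w | agree m t s w0 w])%E.
Proof.
move=> mpos hi; set n := stage (ms w0) s in hi *; set k := (pos (ms w0) s).2.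
set A := [set w | _].
have mA : measurable A by exact: agree_measurable.
have AE : A `&` [set w | target (ms w) (ts w) s = i] =
          [set w | t n.+1 k w = i] `&` A.
  rewrite setIC; apply/seteqP; split => w [/= E a]; split => //;
    move: E; rewrite /target /stage -(determined_pos (leqnn s) a) //.
have graphE w : A w -> (k < m n.+1 w)%N /\ random_partial_graph m t n k w =
    Multigraph (iota 0 n.+2)
      (mkseq (fun r => ((stage (ms w) r).+1, target (ms w) (ts w) r)) s).
  move=> a; have [j hj|] := @timeline_graph (ms w) (ts w) s.
    by rewrite -a.1 //; exact: mpos.
  by rewrite /n /k /stage -(determined_pos (leqnn s) a).
have [_ /(_ A)] := G_process k hi.
rewrite AE => ->; last 2 first.
- exact: agree_history.
- by move=> w /graphE[].
rewrite (eq_integral (cst (chance s w0 i)%:E)) ?integral_cst //.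
move=> w; rewrite inE => Aw; rewrite (graphE _ Aw).2 /=.
rewrite /attachment_probability deg_timeline /chance.
rewrite (determined_degree i (leqnn s) Aw).
rewrite (determined_weight f (leqnn s) Aw) /weight.
rewrite -(determined_stage (leqnn s) Aw) -/n.
by under eq_bigr do rewrite deg_timeline.
Qed.

Section atom.
Variables (s : nat) (w0 : T).
Hypothesis mpos : forall i, (0 < i <= s.+1)%N -> (0 < m i w0)%N.

Let n := stage (ms w0) s.
Let A := [set w | agree m t s w0 w].
Let D i := A `&` [set w | target (ms w) (ts w) s = i].
Let U := \big[setU/set0]_(i <- iota 0 n.+1) D i.

Let D_measurable i : measurable (D i).
Proof.
apply: (@determined_measurable _ _ _ _ m t s.+1); apply: determined_setI.
  by move=> w w' /(agree_homo (leqnSn s)) a; apply/propext; split => h;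
    [exact: agree_trans a|apply: agree_trans (agree_sym a)].
by apply: determined_comp (fun x => x = i) _; exact: determined_target.
Qed.

Let U_measurable : measurable U.
Proof. exact: bigsetU_measurable. Qed.

Let D_disjoint : trivIset [set` iota 0 n.+1] D.
Proof.
apply/trivIsetP => i j _ _ ij; apply/seteqP; split => // w.
by move=> [[_ /= ti] [_ /= tj]]; move: ij; rewrite -ti tj eqxx.
Qed.

Let integral_targets (Z : T -> R) (c : nat -> R) :
  measurable_fun setT Z -> (forall w, A w -> 0 <= Z w) ->
  (forall w, A w -> Z w = c (target (ms w) (ts w) s)) ->
  (\int[P]_(w in U) (Z w)%:E =
   (\sum_(i <- iota 0 n.+1) chance s w0 i * c i)%:E * P A)%E.
Proof.
move=> mZ Z0 Zc; have mA : measurable A by exact: agree_measurable.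
have UA w : U w -> A w.
  by rewrite /U -bigcup_seq => -[i _ []].
rewrite /U ge0_integral_bigsetU ?iota_uniq //; first last.
- by move=> w /UA /Z0; rewrite lee_fin.
- by apply: (measurable_funS measurableT) => //; exact/measurable_EFinP.
have [p Ep] : exists p : R, P A = p%:E.
  by exists (fine (P A)); rewrite fineK // fin_num_measure.
rewrite Ep -EFinM mulr_suml -sumEFin.
rewrite big_seq [RHS]big_seq; apply: eq_bigr => i.
rewrite mem_iota add0n => /andP[_ iN].
rewrite (eq_integral (cst (c i)%:E)); last first.
  by move=> w; rewrite inE => -[Aw /= ti]; rewrite Zc // ti.
rewrite integral_cst //; transitivity ((c i)%:E * ((chance s w0 i)%:E * P A))%E.
  by congr (_ * _)%E; exact: atom_target.
by rewrite Ep -!EFinM; congr EFin; ring.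
Qed.

(** Almost surely the endpoint is one of the candidates: their probabilities
    add up to 1. *)
Let targets_full : P (A `\` U) = 0%E.
Proof.
have mA : measurable A by exact: agree_measurable.
have UA : U `<=` A by rewrite /U -bigcup_seq => w [i _ []].
rewrite measureD // ?ltey_eq ?fin_num_measure // setIC (setIidl UA).
suff E : P U = P A.
  by transitivity (P A - P U)%E => //; rewrite E subee // fin_num_measure.
have E : (\int[P]_(w in U) ((cst 1 : T -> R) w)%:E = P U)%E.
  exact: (etrans (integral_cst P U_measurable 1%:E) (mul1e _)).
rewrite -E (integral_targets (c := cst 1)) //.
by under eq_bigr do rewrite mulr1; rewrite sum_chance mul1e.
Qed.

Lemma atom_drift (Z Z' : T -> R) c :
  determined m t s Z -> determined m t s.+1 Z' ->
  (forall w, A w -> 0 <= Z' w) ->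
  (forall w, A w -> Z' w = c (target (ms w) (ts w) s)) ->
  \sum_(0 <= i < n.+1) chance s w0 i * c i <= Z w0 ->
  (\int[P]_(w in A) (Z' w)%:E <= \int[P]_(w in A) (Z w)%:E)%E.
Proof.
move=> hZ hZ' Z'0 Zc le.
have mA : measurable A by exact: agree_measurable.
have mZ' := determined_measurable_fun hZ'.
have UA : U `<=` A by rewrite /U -bigcup_seq => w [i _ []].
rewrite [leRHS](eq_integral (cst (Z w0)%:E)); last first.
  by move=> w; rewrite inE => Aw; rewrite (hZ _ _ Aw).
rewrite integral_cst //.
have mAU : measurable (A `\` U) by exact: measurableD.
rewrite -[in leLHS](setDUK UA) ge0_integral_setU //; first last.
- by apply/disj_setPS => w [? []].
- by rewrite setDUK // => w /Z'0; rewrite lee_fin.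
- by apply: (measurable_funS measurableT) => //; exact/measurable_EFinP.
rewrite (null_set_integral mAU) ?adde0 ?targets_full //; last first.
  by apply: (measurable_funS measurableT) => //; exact/measurable_EFinP.
rewrite (integral_targets mZ' Z'0 Zc); exact: lee_wpmul2r.
Qed.

End atom.

Lemma null_atom s w0 :
  ~ (forall i, (0 < i <= s.+1)%N -> (0 < m i w0)%N) ->
  P [set w | agree m t s w0 w] = 0%E.
Proof.
move=> /existsNP[i /not_implyP[hi]] /negP; rewrite -eqn0Ngt => /eqP mi.
apply: measure_negligible; first exact: agree_measurable.
have i0 : (0 < i)%N by case/andP: hi.
by apply: negligibleS (m_pos i0) => w a /=; rewrite -(a.1 _ hi) mi.
Qed.

(** The integrals are compared atom by atom. Outcomes with a vertex without edges
    do not follow the timeline, but their atoms are null. *)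
Lemma drift s (A : set T) (Z Z' : T -> R) :
  determined m t s A -> determined m t s Z -> determined m t s.+1 Z' ->
  (forall w, A w -> 0 <= Z w) -> (forall w, A w -> 0 <= Z' w) ->
  (forall w0, A w0 -> exists2 c : nat -> R,
     forall w, agree m t s w0 w -> Z' w = c (target (ms w) (ts w) s) &
     \sum_(0 <= i < (stage (ms w0) s).+1) chance s w0 i * c i <= Z w0) ->
  (\int[P]_(w in A) (Z' w)%:E <= \int[P]_(w in A) (Z w)%:E)%E.
Proof.
move=> hA hZ hZ' Z0 Z'0 step.
have mZ := determined_measurable_fun hZ.
have mZ' := determined_measurable_fun hZ'.
pose C c := A `&` [set w | past_code m t s w = c].
have AE : A = \bigcup_c C c.
  apply/seteqP; split => [w Aw|w [c _ []]//].
  by exists (past_code m t s w).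
have mC c : measurable (C c).
  apply: (@determined_measurable _ _ _ _ m t s); apply: determined_setI => //.
  by move=> w w' /past_codeP /= ->.
have C_disjoint : trivIset setT C.
  apply/trivIsetP => i j _ _ ij; apply/seteqP; split => // w.
  by move=> [[_ /= ci] [_ /= cj]]; move: ij; rewrite -ci cj eqxx.
have mEZ : measurable_fun (\bigcup_c C c) (EFin \o Z).
  by apply: (measurable_funS measurableT) => //; exact/measurable_EFinP.
have mEZ' : measurable_fun (\bigcup_c C c) (EFin \o Z').
  by apply: (measurable_funS measurableT) => //; exact/measurable_EFinP.
rewrite AE [leLHS]ge0_integral_bigcup // ?[leRHS]ge0_integral_bigcup //;
  last 2 first.
- by rewrite -AE => w /Z0; rewrite lee_fin.
- by rewrite -AE => w /Z'0; rewrite lee_fin.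
apply: lee_nneseries => [c _ _|c _].
  by apply: integral_ge0 => w [/Z'0]; rewrite lee_fin.
have [[w0 [Aw0 <-]]|N] := pselect (exists w, A w /\ past_code m t s w = c);
  last first.
  rewrite (_ : C c = set0) ?integral_set0 //; apply/seteqP; split => // w.
  by move=> [Aw cw]; apply: N; exists w.
have hAw w : agree m t s w0 w -> A w by move=> a; rewrite -(hA _ _ a).
rewrite /C determined_atom //.
have [mpos|/null_atom P0] :=
  pselect (forall i, (0 < i <= s.+1)%N -> (0 < m i w0)%N).
  have [c' c'1 c'2] := step w0 Aw0.
  by apply: (atom_drift mpos hZ hZ' _ c'1 c'2) => w /hAw/Z'0.
rewrite null_set_integral // ?integral_ge0 //.
- by move=> w /hAw/Z0; rewrite lee_fin.
- exact: agree_measurable.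
- by apply: (measurable_funS measurableT) => //; exact/measurable_EFinP.
Qed.

Lemma target_le_ae :
  {ae P, forall w, forall s, (target (ms w) (ts w) s <= stage (ms w) s)%N}.
Proof.
apply: ae_foralln => s.
pose B := [set w | (stage (ms w) s < target (ms w) (ts w) s)%N].
have hB : determined m t s.+1 B.
  apply: (determined_pair (fun x y => (x < y)%N : Prop)).
    exact: determined_stage.
  exact: determined_target.
have mB := determined_measurable hB.
suff PB : P B = 0%E.
  by exists B; split => // w /= /negP; rewrite -ltnNge.
apply/eqP; rewrite eq_le measure_ge0 andbT.
have := @drift s setT (cst 0) \1_B; rewrite integral_indic // setIT.
have -> : (\int[P]_w ((cst 0 : T -> R) w)%:E = 0)%E by exact: integral0.
apply => //.
- move=> w w' a; rewrite !indicE; congr (nat_of_bool _)%:R.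
  by apply/idP/idP; rewrite !inE (hB _ _ a).
- move=> w0 _; exists (fun i => (stage (ms w0) s < i)%N%:R).
    move=> w a; rewrite indicE (determined_stage (leqnn s) a).
    by congr (nat_of_bool _)%:R; apply/idP/idP; rewrite inE.
  rewrite big_nat big1 // => i /andP[_]; rewrite ltnS leqNgt => /negPf ->.
  by rewrite mulr0.
Qed.

Lemma m_pos_ae : {ae P, forall w, forall i, (0 < i)%N -> (0 < m i w)%N}.
Proof.
apply: ae_foralln => -[|i]; first exact: aeW.
by apply: filterS (m_pos (ltn0Sn i)).
Qed.

End one_step.

(** * Fluctuations around the clock *)

Section fluctuations.
Context d (T : measurableType d) (R : realType) (P : probability T R).

Lemma disjoint_union_le (A B : nat -> set T) (c : R) : 0 <= c ->
  (forall s, measurable (A s)) -> (forall s, measurable (B s)) ->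
  (forall s, B s `<=` A s) -> trivIset setT A ->
  (forall s, P (B s) <= c%:E * P (A s))%E ->
  (P (\bigcup_s B s) <= c%:E * P (\bigcup_s A s))%E.
Proof.
move=> c0 mA mB BA tA le.
rewrite !measure_semi_bigcup //; try exact: bigcup_measurable; last first.
  apply/trivIsetP => i j _ _ ij; have /trivIsetP/(_ i j I I ij) := tA.
  by rewrite -!subset0 => h; apply: subset_trans h; exact: setISS.
rewrite -nneseriesZl //; apply: lee_nneseries => // s _; exact: le.
Qed.

Variables (f : nat -> R) (m : nat -> {RV P >-> nat})
  (t : nat -> nat -> {RV P >-> nat}).
Hypothesis f_gt0 : forall i, 0 < f i.
Hypothesis f_ndecr : forall i j, (i <= j)%N -> f i <= f j.
Hypothesis Phi2_finite : (Phi_infty f 2 < +oo)%E.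
Hypothesis m_pos : forall i, (0 < i)%N -> {ae P, forall w, (0 < m i w)%N}.
Hypothesis G_process : attachment_process m t f.

Local Notation Phi2oo := (fine (Phi_infty f 2)).
Local Notation ms w := (fun i => m i w).
Local Notation ts w := (fun i k => t i k w).
Local Notation deg_ s v w := (degree (ms w) (ts w) s v).
Local Notation clock_ s w := (clock f (ms w) (ts w) s).
Local Notation weight_ s w := (weight f (ms w) (ts w) s).
Local Notation stage_ s w := (stage (ms w) s).
Local Notation target_ s w := (target (ms w) (ts w) s).

Lemma eventually_measurable s (E : nat -> set T) :
  (forall r, (s <= r)%N -> determined m t r (E r)) ->
  measurable [set w | exists2 r, (s <= r)%N & E r w].
Proof.
move=> hE; rewrite (_ : mkset _ = \bigcup_(r in [set r | (s <= r)%N]) E r).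
  by apply: bigcup_measurable => r sr; exact: determined_measurable (hE _ sr).
by apply/seteqP; split => w [r]; exists r.
Qed.

Lemma process_maximal_inequality s (A : set T) (Z : nat -> T -> R) z l :
  0 < l -> determined m t s A ->
  (forall r, (s <= r)%N -> determined m t r (Z r)) ->
  (forall r w, (s <= r)%N -> A w -> 0 <= Z r w) ->
  (forall w, A w -> Z s w = z) ->
  (forall r w0, (s <= r)%N -> A w0 -> exists2 c : nat -> R,
     forall w, agree m t r w0 w -> Z r.+1 w = c (target_ r w) &
     \sum_(0 <= i < (stage_ r w0).+1) f (deg_ r i w0) / weight_ r w0 * c i
       <= Z r w0) ->
  (P (A `&` [set w | exists2 r, (s <= r)%N & (l <= Z r w)%R])
    <= (z / l)%:E * P A)%E.
Proof.
move=> l0 hA hZ Z0 Zz step.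
apply: (@maximal_inequality _ _ _ P
  (fun r B => determined m t r B /\ B `<=` A)) => //.
- by move=> r B _ [/determined_measurable].
- by move=> r B _ [hB BA]; split => //; exact: determined_homo hB.
- move=> r B sr [hB BA]; split; last by move=> w [/BA].
  apply: determined_setI => //.
  by apply: (determined_comp (fun x => x < l : Prop)); exact: hZ.
- by move=> r sr; exact: determined_measurable_fun (hZ _ sr).
- by move=> r B w sr [_ BA] /BA; exact: Z0.
- move=> r B sr [hB BA]; apply: (drift f_gt0 f_ndecr m_pos G_process hB).
  + exact: hZ.
  + by apply: hZ; exact: leqW.
  + by move=> w /BA; exact: Z0.
  + by move=> w /BA; apply: Z0; exact: leqW.
  + by move=> w0 /BA; exact: step.
- by split.
Qed.

Lemma sum_chance1 s w0 v x y : (v <= stage_ s w0)%N ->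
  \sum_(0 <= i < (stage_ s w0).+1) f (deg_ s i w0) / weight_ s w0 *
     (x + (i == v)%:R * y) =
  x + f (deg_ s v w0) / weight_ s w0 * y.
Proof.
move=> vs; have := sum_chance m t f_gt0 f_ndecr s w0.
rewrite /index_iota subn0 => S1.
under eq_bigr do rewrite mulrDr.
rewrite big_split /= -mulr_suml S1 mul1r; congr (_ + _).
have vN : v \in iota 0 (stage_ s w0).+1 by rewrite mem_iota.
rewrite (bigD1_seq v vN (iota_uniq _ _)) /=.
rewrite eqxx mul1r big1 ?addr0 // => i /negPf ->.
by rewrite mul0r mulr0.
Qed.

Lemma sum_chance2 s w0 u v x y z :
  (u <= stage_ s w0)%N -> (v <= stage_ s w0)%N ->
  \sum_(0 <= i < (stage_ s w0).+1) f (deg_ s i w0) / weight_ s w0 *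
     (x + (i == u)%:R * y + (i == v)%:R * z) =
  x + f (deg_ s u w0) / weight_ s w0 * y + f (deg_ s v w0) / weight_ s w0 * z.
Proof.
move=> us vs; have := sum_chance1 0 z vs; rewrite add0r => <-.
rewrite -(sum_chance1 x y us) -big_split /=; apply: eq_bigr => i _.
by rewrite add0r mulrDr.
Qed.

(** The increments of [Phi f 1] along the degree of [v] and those of the clock
    have the same conditional expectations. The difference has Gaussian tails:
    at each step, [lam] times it is the logarithm of a supermartingale up to the
    quadratic correction [2 * lam ^+ 2] times the increment of [Phi f 2], and
    these corrections add up to a bounded quantity. *)
Lemma fluctuation_le s (A : set T) v lam a :
  - (f 0 / 2) <= lam -> determined m t s A ->
  (forall w, A w -> (v <= stage_ s w)%N) ->
  (P (A `&` [set w | exists2 r, (s <= r)%N &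
        (a <= lam * ((Phi f 1 (deg_ r v w) - Phi f 1 (deg_ s v w)) -
                     (clock_ r w - clock_ s w)))%R])
   <= (expR (- a + 2 * lam ^+ 2 * Phi2oo))%:E * P A)%E.
Proof.
move=> hlam hA vA.
pose Z r w := growth f lam (deg_ s v w) (deg_ r v w) *
              expR (- lam * (clock_ r w - clock_ s w)).
set B := [set w | _].
set l := expR (a - 2 * lam ^+ 2 * Phi2oo).
have hdeg r x : (x <= r)%N -> determined m t r (fun w => deg_ x v w).
  exact: determined_degree.
have hclock r x : (x <= r)%N -> determined m t r (fun w => clock_ x w).
  by move=> xr; apply: determined_clock; exact: leqW.
have mB : measurable B.
  apply: eventually_measurable => r sr w w' e.
  by rewrite (hdeg _ _ sr _ _ e) (hdeg _ _ (leqnn r) _ _ e)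
    (hclock _ _ sr _ _ e) (hclock _ _ (leqnn r) _ _ e).
have hZ r : (s <= r)%N -> determined m t r (Z r).
  move=> sr w w' e.
  by rewrite /Z (hdeg _ _ sr _ _ e) (hdeg _ _ (leqnn r) _ _ e)
    (hclock _ _ sr _ _ e) (hclock _ _ (leqnn r) _ _ e).
set C := [set w | exists2 r, (s <= r)%N & l <= Z r w].
have mC : measurable C.
  apply: eventually_measurable => r sr.
  by apply: (determined_comp (fun x => l <= x : Prop)); exact: hZ.
have mA := determined_measurable hA.
have BC : B `<=` C.
  move=> w [r sr h]; exists r => //; rewrite /Z /l.
  have := growth_ge f_gt0 f_ndecr Phi2_finite hlam
    (degree_homo (ms w) (ts w) v sr).
  move=> /(ler_wpM2r (expR_ge0 (- lam * (clock_ r w - clock_ s w)))).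
  by apply: le_trans; rewrite -expRD ler_expR; lra.
apply: (@le_trans _ _ (P (A `&` C))).
  by apply: le_measure; rewrite ?inE; [exact: measurableI..|exact: setIS].
have -> : expR (- a + 2 * lam ^+ 2 * Phi2oo) = 1 / l.
  by rewrite div1r -expRN opprB addrC.
apply: process_maximal_inequality => //.
- exact: expR_gt0.
- by move=> r w _ _; rewrite mulr_ge0 ?expR_ge0 // growth_ge0.
- by move=> w _; rewrite /Z growth_refl subrr mulr0 expR0 mulr1.
move=> r w0 sr Aw0.
have vr : (v <= stage_ r w0)%N.
  exact: leq_trans (vA _ Aw0) (stage_homo _ sr).
set G := growth f lam (deg_ s v w0) (deg_ r v w0).
set W := weight_ r w0.
set e := expR (- lam * (clock_ r w0 + W^-1 - clock_ s w0)).
exists (fun i => G * e + (i == v)%:R * (G * (lam / f (deg_ r v w0)) * e)).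
  move=> w a0; rewrite /Z degree_step; last first.
    by rewrite -(determined_stage (leqnn r) a0).
  rewrite clockS -(hdeg _ _ sr _ _ a0) -(hdeg _ _ (leqnn r) _ _ a0).
  rewrite -(hclock _ _ sr _ _ a0) -(hclock _ _ (leqnn r) _ _ a0).
  rewrite -(determined_weight f (leqnn r) a0) -/e.
  have dd : (deg_ s v w0 <= deg_ r v w0)%N by exact: degree_homo.
  case: eqVneq => _; last by rewrite addn0 mul0r addr0.
  by rewrite addn1 growthS // -/G mul1r; ring.
rewrite sum_chance1 //.
have W0 : 0 < W by exact: weight_gt0.
have -> : G * e + f (deg_ r v w0) / weight_ r w0 *
    (G * (lam / f (deg_ r v w0)) * e) = G * ((1 + lam / W) * e).
  by rewrite -/W; field; rewrite !gt_eqF.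
rewrite /Z -/G; apply: ler_wpM2l; first exact: growth_ge0.
have -> : e = expR (- (lam / W)) * expR (- lam * (clock_ r w0 - clock_ s w0)).
  by rewrite -expRD /e; congr expR; ring.
rewrite mulrA -[leRHS]mul1r ler_wpM2r ?expR_ge0 //.
rewrite expRN -/(_ / _) ler_pdivrMr ?expR_gt0 // mul1r; exact: expR_ge1Dx.
Qed.

End fluctuations.

(** * Ties between two vertices *)

Section ties.
Context d (T : measurableType d) (R : realType) (P : probability T R).
Variables (f : nat -> R) (m : nat -> {RV P >-> nat})
  (t : nat -> nat -> {RV P >-> nat}).
Hypothesis f_gt0 : forall i, 0 < f i.
Hypothesis f_ndecr : forall i j, (i <= j)%N -> f i <= f j.
Hypothesis Phi2_finite : (Phi_infty f 2 < +oo)%E.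
Hypothesis m_pos : forall i, (0 < i)%N -> {ae P, forall w, (0 < m i w)%N}.
Hypothesis G_process : attachment_process m t f.

Local Notation ms w := (fun i => m i w).
Local Notation ts w := (fun i k => t i k w).
Local Notation deg_ s v w := (degree (ms w) (ts w) s v).
Local Notation weight_ s w := (weight f (ms w) (ts w) s).
Local Notation stage_ s w := (stage (ms w) s).
Local Notation target_ s w := (target (ms w) (ts w) s).

Variables u v : nat.
Hypothesis uv : u != v.

Definition tied L s : set T := [set w |
  [/\ (u <= stage_ s w)%N, (v <= stage_ s w)%N, deg_ s u w = deg_ s v w
    & (L <= deg_ s u w)%N]].

Definition tied_unboundedly : set T :=
  [set w | forall L, exists s, tied L s w].

Lemma determined_tied L r s : (r <= s)%N -> determined m t s (tied L r).
Proof.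
move=> rs w w' a; rewrite /tied /= (determined_stage rs a).
by rewrite (determined_degree u rs a) (determined_degree v rs a).
Qed.

Lemma tied_unboundedlyE :
  tied_unboundedly = \bigcap_L \bigcup_s tied L s.
Proof.
apply/seteqP; split => w h L.
  by move=> _; have [s hs] := h L; exists s.
by have [//|s _ hs] := h L; exists s.
Qed.

Lemma tied_measurable L s : measurable (tied L s).
Proof. exact: determined_measurable (determined_tied L (leqnn s)). Qed.

Lemma tied_unboundedly_measurable : measurable tied_unboundedly.
Proof.
rewrite tied_unboundedlyE; apply: bigcap_measurableType => L _.
by apply: bigcup_measurable => s _; exact: tied_measurable.
Qed.

Let kappa : R := (1 + expR 1) / (3 / 2 + expR 1).

(** The alignment is a martingale with values at least [- expR 1]. It starts at 1
    from a tie, and it is at least [3 / 2] at every later tie of high level: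
    such a tie has probability at most [kappa]. *)
Lemma tie_again_le s (A : set T) :
  determined m t s A -> A `<=` tied 0 s ->
  (P (tied_unboundedly `&` A) <= kappa%:E * P A)%E.
Proof.
move=> hA At; have e0 := expR_gt0 (1 : R).
pose Z r w := tie_potential f (deg_ s u w) (deg_ r u w) (deg_ r v w) + expR 1.
have hZ r : (s <= r)%N -> determined m t r (Z r).
  move=> sr w w' a; rewrite /Z (determined_degree u sr a).
  by rewrite (determined_degree u (leqnn r) a) (determined_degree v (leqnn r) a).
set C := [set w | exists2 r, (s <= r)%N & 3 / 2 + expR 1 <= Z r w].
have mC : measurable C.
  apply: eventually_measurable => r sr.
  by apply: (determined_comp (fun x => 3 / 2 + expR 1 <= x : Prop)); exact: hZ.
have mA := determined_measurable hA.
have sub : tied_unboundedly `&` A `<=` A `&` C.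
  move=> w [hw Aw]; split => //.
  have [K HK] := tie_potential_far f_gt0 Phi2_finite (deg_ s u w).
  have [r [_ _ uvr]] := hw (maxn K (deg_ s u w).+1).
  rewrite geq_max => /andP[Kr sr].
  have {}sr' : (s <= r)%N.
    rewrite leqNgt; apply/negP => /ltnW/(degree_homo (ms w) (ts w) u).
    by rewrite leqNgt sr.
  exists r => //; rewrite /Z -uvr lerD2r; apply: HK => //; exact: ltnW.
apply: (@le_trans _ _ (P (A `&` C))).
  apply: le_measure sub; rewrite ?inE; apply: measurableI => //.
  exact: tied_unboundedly_measurable.
have start r w : (s <= r)%N -> A w ->
    (deg_ s u w <= deg_ r u w)%N /\ (deg_ s u w <= deg_ r v w)%N.
  by move=> sr /At[_ _ E _]; rewrite [in X in _ /\ X]E; split; exact: degree_homo.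
apply: (process_maximal_inequality f_gt0 f_ndecr m_pos G_process) => //.
- move=> r w sr Aw; have [h1 h2] := start r w sr Aw.
  by rewrite /Z -lerBlDr sub0r; exact: tie_potential_ge.
- by move=> w /At[_ _ E _]; rewrite /Z -E tie_potential_start.
move=> r w0 sr Aw0; have [us vs _ _] := At _ Aw0.
have ur : (u <= stage_ r w0)%N by exact: leq_trans us (stage_homo _ sr).
have vr : (v <= stage_ r w0)%N by exact: leq_trans vs (stage_homo _ sr).
have [h1 h2] := start r w0 sr Aw0.
set k := deg_ s u w0; set a := deg_ r u w0; set b := deg_ r v w0.
pose g := tie_potential f k.
exists (fun i => g a b + expR 1 + (i == u)%:R * (g a.+1 b - g a b)
                 + (i == v)%:R * (g a b.+1 - g a b)).
  move=> w a0; rewrite /Z.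
  rewrite !degree_step -?(determined_stage (leqnn r) a0) //.
  rewrite -(determined_degree u sr a0) -(determined_degree u (leqnn r) a0).
  rewrite -(determined_degree v (leqnn r) a0) -/k -/a -/b -/g.
  case: (eqVneq _ u) => [->|_]; first by rewrite (negPf uv) addn0 addn1 mul1r mul0r; ring.
  by case: (eqVneq _ v) => _; rewrite addn0 ?addn0 ?addn1 ?mul1r !mul0r; ring.
rewrite sum_chance2 // -/a -/b /Z -/k -/a -/b -/g.
have := alignment_harmonic f_gt0 (tie_angle f k) h1 h2.
rewrite -/(tie_potential f k _ _) -/g -/a -/b.
have W0 : 0 < weight_ r w0 by exact: weight_gt0.
move=> H; rewrite -[leRHS]addr0 -addrA lerD2l.
by rewrite !(mulrAC _ _^-1) -mulrDl H mul0r.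
Qed.

Let first_tie L s : set T := tied L s `&` \bigcap_(r in `I_s) ~` tied L r.

Let determined_first_tie L s : determined m t s (first_tie L s).
Proof.
apply: determined_setI; first exact: determined_tied.
move=> w w' a; apply/propext; split => h r rs; move: (h r rs) => /=;
  by rewrite (determined_tied L (ltnW rs) a).
Qed.

Let bigcup_first_tie L : \bigcup_s first_tie L s = \bigcup_s tied L s.
Proof.
apply/seteqP; split => w [s _ hs]; first by exists s => //; case: hs.
have [r [hr mr]] : exists r, tied L r w /\ forall q, (q < r)%N -> ~ tied L q w.
  have ex : exists s, `[< tied L s w >] by exists s; apply/asboolP.
  exists (ex_minn ex); case: ex_minnP => r /asboolP hr mr; split => // q qr.
  by move=> /asboolP/mr; rewrite leqNgt qr.
by exists r.
Qed.

Let first_tie_disjoint L : trivIset setT (first_tie L).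
Proof.
apply/trivIsetP => i j _ _; case: ltngtP => // ij _;
  apply/seteqP; split => // w [[hi mi] [hj mj]].
  by case: (mj i ij).
by case: (mi j ij).
Qed.

(** Conditionally on a first tie of level at least [L], further ties of
    unbounded levels have probability at most [kappa]. As [L] grows, the
    probability of such a first tie decreases to that of ties of unbounded
    levels. *)
Lemma tied_unboundedly_null : P tied_unboundedly = 0%E.
Proof.
have e0 := expR_gt0 (1 : R).
have k0 : 0 <= kappa by rewrite /kappa divr_ge0 // addr_ge0 // ltW.
have k1 : kappa < 1 by rewrite /kappa ltr_pdivrMr ?addr_gt0 // mul1r; lra.
have mT := tied_unboundedly_measurable.
pose E L := \bigcup_s tied L s.
have mE L : measurable (E L).
  by apply: bigcup_measurable => s _; exact: tied_measurable.
have le L : (P tied_unboundedly <= kappa%:E * P (E L))%E.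
  have mF s := determined_measurable (@determined_first_tie L s).
  have -> : tied_unboundedly = \bigcup_s (tied_unboundedly `&` first_tie L s).
    rewrite -setI_bigcupr bigcup_first_tie; apply/seteqP.
    split => [w hw|w []//]; split => //.
    by have [s hs] := hw L; exists s.
  rewrite /E -bigcup_first_tie; apply: disjoint_union_le => //.
  - by move=> s; exact: measurableI.
  - move=> s; apply: tie_again_le; first exact: determined_first_tie.
    by move=> w [[a b c _] _]; split.
have cE : (P \o E) @ \oo --> P tied_unboundedly.
  rewrite tied_unboundedlyE; apply: nonincreasing_cvg_mu => //.
  - by rewrite ltey_eq fin_num_measure.
  - by rewrite -tied_unboundedlyE.
  - move=> a b ab; apply/subsetPset => w [s _ [h1 h2 h3 h4]].
    by exists s => //; split => //; exact: leq_trans h4.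
have c : (kappa%:E * P (E L))%E @[L --> \oo] --> (kappa%:E * P tied_unboundedly)%E.
  exact: cvgeZl.
have : (P tied_unboundedly <= kappa%:E * P tied_unboundedly)%E.
  rewrite -(cvg_lim _ c) //; apply: lime_ge; last by apply: nearW => L.
  by apply/cvg_ex; eexists; exact: c.
have [p Ep] : exists p : R, P tied_unboundedly = p%:E.
  by exists (fine (P tied_unboundedly)); rewrite fineK // fin_num_measure.
have p0 : 0 <= p by rewrite -lee_fin -Ep measure_ge0.
by rewrite Ep lee_fin => h; congr EFin; nra.
Qed.

End ties.

Section eventual_order.
Variables (m : nat -> nat) (t : nat -> nat -> nat).
Hypothesis mpos : forall i, (0 < i)%N -> (0 < m i)%N.

(** Two degrees cannot cross without a tie, as an edge raises at most one of
    them. If ties have bounded levels, then there is no tie once one of the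
    degrees is large; and if both degrees stay bounded, then they are eventually
    constant. *)
Lemma eventually_ordered u v L : u != v ->
  (forall s, (u <= stage m s)%N -> (v <= stage m s)%N ->
     degree m t s u = degree m t s v -> (degree m t s u < L)%N) ->
  exists s0, (forall s, (s0 <= s)%N -> (degree m t s u <= degree m t s v)%N) \/
             (forall s, (s0 <= s)%N -> (degree m t s v <= degree m t s u)%N).
Proof.
move=> uv noties; have [s1 ps1] := exists_pos mpos (maxn u v).
have born s : (s1 <= s)%N -> (u <= stage m s)%N /\ (v <= stage m s)%N.
  move=> /(stage_homo m); rewrite {1}/stage ps1 /= geq_max.
  by move=> /andP.
have step s : (s1 <= s)%N -> degree m t s.+1 u = degree m t s u \/
      degree m t s.+1 v = degree m t s v.
  move=> /born[us vs]; rewrite !degree_step //.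
  case: (eqVneq (target m t s) u) => [->|_]; last by left; rewrite addn0.
  by right; rewrite (negPf uv) addn0.
have mono x r s : (r <= s)%N -> (degree m t r x <= degree m t s x)%N.
  exact: degree_homo.
have [[s2 [s12 big]]|small] := pselect (exists s, (s1 <= s)%N /\
    ((L <= degree m t s u) || (L <= degree m t s v))%N).
- have untied s : (s2 <= s)%N -> degree m t s u != degree m t s v.
    move=> s2s; apply/eqP => e; have [us vs] := born _ (leq_trans s12 s2s).
    have := noties s us vs e; have := mono u _ _ s2s; have := mono v _ _ s2s.
    by case/orP: big; lia.
  have keep s : (s2 <= s)%N -> degree m t s.+1 u = degree m t s u \/
      degree m t s.+1 v = degree m t s v.
    by move=> s2s; apply: step; exact: leq_trans s2s.
  have slow s : (s2 <= s)%N -> (degree m t s.+1 u <= (degree m t s u).+1)%N /\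
      (degree m t s.+1 v <= (degree m t s v).+1)%N.
    move=> s2s; have [us vs] := born _ (leq_trans s12 s2s).
    by split; rewrite degree_step // -[leqRHS]addn1 leq_add2l leq_b1.
  exists s2; have := untied s2 (leqnn _).
  rewrite neq_ltn => /orP[lt|lt]; [left|right] => s /subnK <-;
    apply: ltnW; elim: (s - s2)%N => // k IH.
  + have := untied (k.+1 + s2)%N (leq_addl _ _).
    have := slow (k + s2)%N (leq_addl _ _).
    have := keep (k + s2)%N (leq_addl _ _); rewrite !addSn.
    have := mono v _ _ (leqnSn (k + s2)); have := mono u _ _ (leqnSn (k + s2)).
    lia.
  + have := untied (k.+1 + s2)%N (leq_addl _ _).
    have := slow (k + s2)%N (leq_addl _ _).
    have := keep (k + s2)%N (leq_addl _ _); rewrite !addSn.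
    have := mono v _ _ (leqnSn (k + s2)); have := mono u _ _ (leqnSn (k + s2)).
    lia.
- pose tot s := (degree m t s u + degree m t s v)%N.
  have bd s : (s1 <= s)%N -> (tot s <= 2 * L)%N.
    move=> s1s; rewrite leqNgt; apply/negP; rewrite /tot => h.
    by apply: small; exists s; split => //; lia.
  have ex : exists k, `[< exists2 s, (s1 <= s)%N & tot s = k >].
    by exists (tot s1); apply/asboolP; exists s1.
  have ub k : `[< exists2 s, (s1 <= s)%N & tot s = k >] -> (k <= 2 * L)%N.
    by move=> /asboolP[s s1s <-]; exact: bd.
  have := ex_maxnP ex ub; set K := ex_maxn _ _.
  case=> K' /asboolP[s2 s12 E2] maxK.
  have const s : (s2 <= s)%N -> degree m t s u = degree m t s2 u /\
      degree m t s v = degree m t s2 v.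
    move=> s2s; have := mono u _ _ s2s; have := mono v _ _ s2s.
    have : (tot s <= K')%N.
      by apply: maxK; apply/asboolP; exists s => //; exact: leq_trans s2s.
    by rewrite -E2 /tot; lia.
  exists s2; have [le|lt] := leqP (degree m t s2 u) (degree m t s2 v).
    by left => s /const[-> ->].
  by right => s /const[-> ->]; exact: ltnW.
Qed.

End eventual_order.

(** * Light tails: a persistent hub *)

Section almost_sure.
Context d (T : measurableType d) (R : realType) (P : probability T R).

Lemma eq0_of_le_div (p K : R) : 0 <= p -> (forall n : nat, p * n%:R <= K) ->
  p = 0.
Proof.
move=> p0 h; apply/eqP; rewrite eq_le p0 andbT leNgt; apply/negP => p1.
have := h (Num.truncn (K / p)).+1; rewrite leNgt => /negP; apply.
by rewrite -ltr_pdivrMl // mulrC truncnS_gt.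
Qed.

Lemma null_of_expR_bound (N : set T) (K : R) : measurable N ->
  (forall n : nat, P N <= (expR (- n%:R + K))%:E)%E -> P N = 0%E.
Proof.
move=> mN h; have [p Ep] : exists p : R, P N = p%:E.
  by exists (fine (P N)); rewrite fineK // fin_num_measure.
have p0 : 0 <= p by rewrite -lee_fin -Ep measure_ge0.
rewrite Ep (@eq0_of_le_div p (expR K)) // => n.
have := h n; rewrite Ep lee_fin expRD expRN mulrC ler_pdivlMr ?expR_gt0 //.
apply: le_trans; rewrite ler_wpM2l //.
by apply: le_trans (expR_ge1Dx _); rewrite lerDr.
Qed.

Lemma summable_telescope_ae (F : nat -> set T) (K : R) (n1 : nat) : 0 <= K ->
  (forall n, measurable (F n)) ->
  (forall n, (n1 <= n)%N -> P (F n) <= (K * (n.+1%:R^-1 - n.+2%:R^-1))%:E)%E ->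
  {ae P, forall w, exists N, forall n, (N <= n)%N -> ~ F n w}.
Proof.
move=> K0 mF le; pose G n := if (n < n1)%N then set0 else F n.
have mG n : measurable (G n) by rewrite /G; case: ifP.
have b0 n : 0 <= n.+1%:R^-1 - n.+2%:R^-1 :> R.
  by rewrite subr_ge0 lef_pV2 ?posrE // ler_nat.
have leG n : (P (G n) <= (K * (n.+1%:R^-1 - n.+2%:R^-1))%:E)%E.
  rewrite /G; case: ltnP => [_|/le//].
  by rewrite measure0 lee_fin mulr_ge0.
have fin : (\sum_(n <oo) P (G n) < +oo)%E.
  apply: (@le_lt_trans _ _ K%:E); last exact: ltry.
  apply: lime_le; first by apply: is_cvg_nneseries => n _ _.
  apply: nearW => n; apply: (le_trans (lee_sum _ (fun i _ => leG i))).
  rewrite sumEFin -mulr_sumr lee_fin -[leRHS]mulr1 ler_wpM2l //.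
  have := @telescope_sumr R 0 n (fun i => - i.+1%:R^-1) (leq0n n).
  rewrite invr1 opprK.
  under eq_bigr do rewrite opprK addrC.
  by move=> ->; rewrite addrC lerBlDr lerDl invr_ge0.
have := lim_sup_set_cvg0 mG fin => N0.
have mL : measurable (lim_sup_set G).
  apply: bigcap_measurable => // k _; apply: bigcup_measurable => j _.
  exact: mG.
exists (lim_sup_set G); split => // w /= h n _.
apply: contrapT => h'; apply: h; exists (maxn n n1) => k.
rewrite geq_max => /andP[nk n1k] Fk; apply: h'; exists k => //.
by rewrite /G ltnNge n1k.
Qed.

Variables (f : nat -> R) (m : nat -> {RV P >-> nat})
  (t : nat -> nat -> {RV P >-> nat}).
Hypothesis f_gt0 : forall i, 0 < f i.
Hypothesis f_ndecr : forall i j, (i <= j)%N -> f i <= f j.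
Hypothesis Phi2_finite : (Phi_infty f 2 < +oo)%E.
Hypothesis m_pos : forall i, (0 < i)%N -> {ae P, forall w, (0 < m i w)%N}.
Hypothesis G_process : attachment_process m t f.

Local Notation Phi2oo := (fine (Phi_infty f 2)).
Local Notation ms w := (fun i => m i w).
Local Notation ts w := (fun i k => t i k w).
Local Notation deg_ s v w := (degree (ms w) (ts w) s v).
Local Notation clock_ s w := (clock f (ms w) (ts w) s).
Local Notation stage_ s w := (stage (ms w) s).

Definition deviates s v lam a : set T := [set w | exists2 r, (s <= r)%N &
  a <= lam * ((Phi f 1 (deg_ r v w) - Phi f 1 (deg_ s v w)) -
              (clock_ r w - clock_ s w))].

Lemma deviates_measurable s v lam a : measurable (deviates s v lam a).
Proof.
apply: (@eventually_measurable _ _ _ _ m t) => r sr w w' e.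
have rr := leqnn r.
rewrite (determined_degree v sr e) (determined_degree v rr e).
by rewrite (determined_clock f (leqW sr) e) (determined_clock f (leqW rr) e).
Qed.

(** The time at which [v] becomes a candidate is random: a bound is obtained from
    each fixed time at which it is one. *)
Lemma fluctuation_bounded v lam : - (f 0 / 2) <= lam ->
  {ae P, forall w, exists C, forall s, (v <= stage_ s w)%N ->
    lam * (Phi f 1 (deg_ s v w) - clock_ s w) <= C}.
Proof.
move=> hlam.
have : {ae P, forall w, forall s, (v <= stage_ s w)%N ->
    exists C : nat, ~ deviates s v lam C%:R w}.
  apply: ae_foralln => s.
  pose A := [set w | (v <= stage_ s w)%N].
  have hA : determined m t s A.
    by apply: (determined_comp (fun x => (v <= x)%N : Prop));
      exact: determined_stage.
  pose N := \bigcap_(C : nat) (A `&` deviates s v lam C%:R).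
  have mA := determined_measurable hA.
  have mAC C : measurable (A `&` deviates s v lam C).
    by apply: measurableI => //; exact: deviates_measurable.
  have mN : measurable N by exact: bigcap_measurableType.
  exists N; split => //; last first.
    move=> w /= /not_implyP[Aw h] C _; split => //.
    by apply: contrapT => h'; apply: h; exists C.
  apply: (@null_of_expR_bound _ (2 * lam ^+ 2 * Phi2oo)) => // C.
  apply: (@le_trans _ _ (P (A `&` deviates s v lam C%:R))).
    by apply: le_measure; rewrite ?inE //; exact: bigcap_inf.
  apply: (le_trans (fluctuation_le f_gt0 f_ndecr Phi2_finite m_pos G_process
    _ hlam hA _)) => //.
  by rewrite -[leRHS]mule1; apply: lee_wpmul2l;
    rewrite ?lee_fin ?expR_ge0 ?probability_le1.
apply: filterS => w h.
have [[s vs]|none] := pselect (exists s, (v <= stage_ s w)%N); last first.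
  by exists 0 => s vs; case: none; exists s.
have ex : exists s, (v <= stage_ s w)%N by exists s.
have := ex_minnP ex; set s0 := ex_minn _; case=> s1 vs1 min1.
have [C hC] := h s1 vs1.
exists (C%:R + lam * (Phi f 1 (deg_ s1 v w) - clock_ s1 w)) => r vr.
have s1r := min1 r vr.
apply: ltW; rewrite ltNge; apply/negP => le; apply: hC; exists r => //.
by move: le; lra.
Qed.

Lemma hub_among_first (N : nat) w :
  (forall u v, u != v -> ~ tied_unboundedly m t u v w) ->
  (forall i, (0 < i)%N -> (0 < m i w)%N) ->
  exists v s0, (v <= N)%N /\
    forall s u, (s0 <= s)%N -> (u <= N)%N -> (deg_ s u w <= deg_ s v w)%N.
Proof.
move=> untied mpos.
have order u v : exists s0,
    (forall s, (s0 <= s)%N -> (deg_ s u w <= deg_ s v w)%N) \/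
    (forall s, (s0 <= s)%N -> (deg_ s v w <= deg_ s u w)%N).
  case: (eqVneq u v) => [->|uv]; first by exists 0%N; left.
  have /existsNP[L hL] := untied u v uv.
  apply: (@eventually_ordered (ms w) (ts w) mpos u v L uv) => s us vs e.
  by rewrite ltnNge; apply/negP => Ls; apply: hL; exists s; split.
elim: N => [|N [v [s0 [vN hv]]]].
  exists 0%N, 0%N; split => // s u _; rewrite leqn0 => /eqP -> //.
have [s1 [h|h]] := order N.+1 v.
  exists v, (maxn s0 s1); split => [|s u]; first exact: leqW.
  rewrite geq_max => /andP[a b]; rewrite leq_eqVlt => /orP[/eqP->|]; first exact: h.
  by rewrite ltnS; exact: hv.
exists N.+1, (maxn s0 s1); split => // s u.
rewrite geq_max => /andP[a b]; rewrite leq_eqVlt => /orP[/eqP->//|].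
by rewrite ltnS => uN; apply: leq_trans (h s b); exact: hv.
Qed.

Lemma persistent_hub_of_late N w :
  (forall u v, u != v -> ~ tied_unboundedly m t u v w) ->
  (forall i, (0 < i)%N -> (0 < m i w)%N) ->
  (forall n s, (N <= n)%N -> (n <= stage_ s w)%N ->
     (deg_ s n w <= deg_ s 0 w)%N) ->
  persistent_hub (fun n => random_graph m t n w).
Proof.
move=> untied mpos late; have [v [s0 [vN hv]]] := hub_among_first N untied mpos.
exists (maxn s0 N), v => n; rewrite geq_max => /andP[s0n Nn].
have [s ps] := exists_pos mpos n.
have st : stage_ s w = n by rewrite /stage ps.
have s0s : (s0 <= s)%N.
  by apply: leq_trans s0n _; rewrite -st; exact: stage_le.
rewrite /random_graph; split.
  by rewrite vertices_graph // mem_iota /= ltnS (leq_trans vN).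
move=> u; rewrite vertices_graph // mem_iota /= add0n ltnS => un.
rewrite !(deg_graph (ts w) mpos _ ps); have [uN|Nu] := leqP u N; first exact: hv.
apply: leq_trans (hv s 0%N s0s (leq0n N)).
by apply: late; [exact: ltnW | rewrite st].
Qed.

End almost_sure.

Lemma powR_superlinear (R : realType) (p M : R) : 1 < p -> 0 <= M ->
  exists2 y0, 0 < y0 & forall y, y0 <= y -> M * y <= y `^ p.
Proof.
move=> p1 M0; exists (Num.max 1 (M `^ (p - 1)^-1)); first by rewrite lt_max ltr01.
move=> y; rewrite ge_max => /andP[y1 yM].
have y0 : 0 < y by exact: lt_le_trans y1.
have -> : p = 1 + (p - 1) by lra.
rewrite powRD; last by rewrite (gt_eqF y0) implybT.
rewrite powRr1 ?(ltW y0) // mulrC ler_pM2l //.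
have <- : (M `^ (p - 1)^-1) `^ (p - 1) = M.
  by rewrite -powRrM mulVf ?powRr1 // gt_eqF // subr_gt0.
by apply: ge0_ler_powR => //; rewrite ?subr_ge0 ?nnegrE ?powR_ge0 // ltW.
Qed.

Section light_tail.
Context d (T : measurableType d) (R : realType) (P : probability T R).
Variables (f : nat -> R) (m : nat -> {RV P >-> nat})
  (t : nat -> nat -> {RV P >-> nat}).
Hypothesis f_gt0 : forall i, 0 < f i.
Hypothesis f_ndecr : forall i j, (i <= j)%N -> f i <= f j.
Hypothesis Phi2_finite : (Phi_infty f 2 < +oo)%E.
Hypothesis m_pos : forall i, (0 < i)%N -> {ae P, forall w, (0 < m i w)%N}.
Hypothesis G_process : attachment_process m t f.

Local Notation Phi2oo := (fine (Phi_infty f 2)).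
Local Notation ms w := (fun i => m i w).
Local Notation ts w := (fun i k => t i k w).
Local Notation deg_ s v w := (degree (ms w) (ts w) s v).
Local Notation clock_ s w := (clock f (ms w) (ts w) s).
Local Notation stage_ s w := (stage (ms w) s).

Lemma inv_sqr_le_telescope (n : nat) :
  n.+1%:R^-1 ^+ 2 <= 2 * (n.+1%:R^-1 - n.+2%:R^-1) :> R.
Proof.
have x0 : 0 < n.+1%:R :> R by [].
have x1 : 1 <= n.+1%:R :> R by rewrite ler1n.
rewrite -[n.+2%:R]natr1; set x := n.+1%:R in x0 x1 *.
have -> : 2 * (x^-1 - (x + 1)^-1) = x^-1 ^+ 2 * (2 * x / (x + 1)).
  by field; rewrite !gt_eqF // addr_gt0.
rewrite ler_peMr ?sqr_ge0 // ler_pdivlMr ?addr_gt0 //; lra.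
Qed.

Lemma expR_N2ln (n : nat) : expR (- (2 * ln n.+1%:R)) = n.+1%:R^-1 ^+ 2 :> R.
Proof.
have -> : - (2 * ln n.+1%:R) = - ln n.+1%:R - ln n.+1%:R :> R by ring.
by rewrite expRD expRN lnK ?posrE // expr2.
Qed.

(** Over all vertices, deviations of the order of the logarithm of the index
    have summable probabilities. *)
Lemma newborn_deviation lam : - (f 0 / 2) <= lam ->
  {ae P, forall w, exists N, forall n, (N <= n)%N ->
     forall s, pos (ms w) s = (n, 0%N) -> ~ deviates f m t s n lam (2 * ln n.+1%:R) w}.
Proof.
move=> hlam.
pose A n s := [set w | pos (ms w) s = (n, 0%N)].
pose B n s := A n s `&` deviates f m t s n lam (2 * ln n.+1%:R).
have hA n s : determined m t s (A n s).
  by apply: (determined_comp (fun x => x = (n, 0%N))); exact: determined_pos.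
have mA n s : measurable (A n s) by exact: determined_measurable (@hA n s).
have mB n s : measurable (B n s).
  by apply: measurableI => //; exact: deviates_measurable.
pose K := 2 * lam ^+ 2 * Phi2oo.
have le n : (P (\bigcup_s B n s) <=
    (2 * expR K * (n.+1%:R^-1 - n.+2%:R^-1))%:E)%E.
  apply: (@le_trans _ _ ((expR (- (2 * ln n.+1%:R) + K))%:E *
      P (\bigcup_s A n s))%E).
    apply: disjoint_union_le => //.
    - by move=> s w [].
    - apply/trivIsetP => i j _ _ ij; apply/seteqP; split => // w [/= a b].
      by move: ij; rewrite (@pos_inj (ms w) i j) ?eqxx // a b.
    - move=> s; apply: fluctuation_le => //.
      by move=> w; rewrite /A /stage /= => ->.
  apply: (@le_trans _ _ (expR (- (2 * ln n.+1%:R) + K))%:E).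
    rewrite -[leRHS]mule1; apply: lee_wpmul2l; first by rewrite lee_fin expR_ge0.
    by apply: probability_le1; exact: bigcup_measurable.
  rewrite lee_fin expRD expR_N2ln mulrC mulrAC [leRHS]mulrC.
  by rewrite ler_wpM2l ?expR_ge0 // inv_sqr_le_telescope.
have K0 : 0 <= 2 * expR K by rewrite mulr_ge0 ?expR_ge0.
have mU n : measurable (\bigcup_s B n s) by exact: bigcup_measurable.
have := summable_telescope_ae K0 mU (fun n (_ : (0 <= n)%N) => le n).
apply: filterS => w [N hN]; exists N => n Nn s ps dev.
by apply: (hN n Nn); exists s.
Qed.

Hypothesis m_id : identically_distributed m.

Lemma light_tail_newborn (c D z0 theta : R) : 0 < c -> 0 < D -> 1 < theta ->
  (forall z, z0 <= z ->
     (P [set w | (z < Phi f 1 (m 1%N w))%R] <= (expR (- D * z `^ theta))%:E)%E) ->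
  {ae P, forall w, exists N, forall n, (N <= n)%N ->
     Phi f 1 (m n w) <= c * ln n.+1%:R}.
Proof.
move=> c0 D0 th1 tail.
pose F n := m n @^-1` [set x | c * ln n.+1%:R < Phi f 1 x].
have mF n : measurable (F n) by exact: nat_event.
pose M := 2 / (c * D).
have M0 : 0 <= M by rewrite divr_ge0 // mulr_ge0 // ltW.
have [y0 _ hy0] := powR_superlinear th1 M0; pose z1 := Num.max z0 y0.
pose n1 := (Num.truncn (expR (z1 / c))).+1.
have late n : (n1 <= n)%N -> z1 <= c * ln n.+1%:R.
  move=> n1n; rewrite mulrC -ler_pdivrMr // -[leLHS]expRK ler_ln ?posrE ?expR_gt0 //.
  apply: le_trans (ltW (truncnS_gt _)) _; rewrite ler_nat.
  exact: leqW.
have le n : (n1 <= n)%N ->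
    (P (F n) <= (2 * (n.+1%:R^-1 - n.+2%:R^-1))%:E)%E.
  move=> n1n; have n0 : (0 < n)%N by exact: leq_trans n1n.
  have zn := late n n1n; set z := c * ln n.+1%:R in zn *.
  have -> : P (F n) = P [set w | (z < Phi f 1 (m 1%N w))%R].
    have := congr1 (fun mu => mu [set x | z < Phi f 1 x])
      (m_id n0 (ltn0Sn 0)).
    by [].
  move: zn; rewrite ge_max => /andP[zz0 /hy0 zM].
  apply: (le_trans (tail _ zz0)); rewrite lee_fin.
  apply: le_trans (inv_sqr_le_telescope n).
  rewrite -expR_N2ln ler_expR mulNr lerN2.
  have -> : 2 * ln n.+1%:R = D * (M * z).
    by rewrite /z /M; field; rewrite !gt_eqF.
  by rewrite ler_pM2l.
have := summable_telescope_ae (ler0n _ 2) mF le.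
by apply: filterS => w [N hN]; exists N => n /hN; rewrite /F /= => /negP; rewrite -leNgt.
Qed.

(** Against the clock, the degree of [v_0] loses at most a constant, whereas a
    late vertex [v_n] starts with a delay of the order of [ln n] that it does not
    catch up. *)
Lemma light_tail_late (Cf D z0 theta : R) :
  0 < Cf -> (forall i, f i <= Cf * i.+1%:R) -> 0 < D -> 1 < theta ->
  (forall z, z0 <= z ->
     (P [set w | (z < Phi f 1 (m 1%N w))%R] <= (expR (- D * z `^ theta))%:E)%E) ->
  {ae P, forall w, exists N, forall n s, (N <= n)%N -> (n <= stage_ s w)%N ->
     (deg_ s n w <= deg_ s 0 w)%N}.
Proof.
move=> Cf0 fC D0 th1 tail.
pose c : R := (3 * Cf)^-1; have c0 : 0 < c by rewrite invr_gt0 mulr_gt0.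
have c20 : 0 < c / 2 by rewrite divr_gt0.
have f00 := f_gt0 0.
(* With this [lam], deviations of [2 * ln n] of the exponent are fluctuations of
   [c / 4 * ln n], a quarter of the lower bound for the clock at the birth. *)
have hlam : - (f 0 / 2) <= 8 / c.
  by apply: (@le_trans _ _ 0); rewrite ?oppr_le0 ?divr_ge0 ?ltW.
have ae1 := target_le_ae f_gt0 f_ndecr m_pos G_process.
have ae2 := fluctuation_bounded f_gt0 f_ndecr Phi2_finite m_pos G_process 0
  (lexx (- (f 0 / 2))).
have ae3 := light_tail_newborn c20 D0 th1 tail.
have ae4 := newborn_deviation hlam.
apply: filterS (filterI (filterI ae1 (m_pos_ae m_pos)) (filterI ae2 (filterI ae3 ae4))).
move=> w [[tle mpos] [[C hC] [[N1 hN1] [N2 hN2]]]].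
pose C' := (f 0 / 2)^-1 * C.
have hC' s : clock_ s w - Phi f 1 (deg_ s 0 w) <= C'.
  rewrite /C' ler_pdivlMl ?divr_gt0 //.
  by have := hC s (leq0n _); rewrite mulNr -mulrN opprB.
pose N3 := (Num.truncn (expR (4 * C' / c))).+1.
exists (maxn N1 (maxn N2 N3)) => n s; rewrite !geq_max => /and3P[n1 n2 n3] ns.
have [s0 ps0] := exists_pos mpos n.
have st0 : stage_ s0 w = n by rewrite /stage ps0.
have s0s : (s0 <= s)%N.
  rewrite leqNgt; apply/negP => /(@pos_lex (ms w)); rewrite st0 ps0 /=; lia.
case: n => [|n] in n1 n2 n3 ns ps0 st0 *; first by [].
pose L : R := ln n.+2%:R.
have L_C : C' <= c / 4 * L.
  have : 4 * C' / c <= L.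
    rewrite /L -[leLHS]expRK ler_ln ?posrE ?expR_gt0 //.
    apply: le_trans (ltW (truncnS_gt _)) _; rewrite ler_nat.
    exact: leqW.
  by rewrite ler_pdivrMr //; lra.
have clock0 : c * L <= clock_ s0 w.
  apply: le_trans (clock_ge (ms w) (ts w) f_gt0 f_ndecr s0 Cf0 fC).
  rewrite ler_pM2l // ler_ln ?posrE // ler_nat ltnS.
  by rewrite -[X in (X <= _)%N]st0; exact: stage_le.
have born : Phi f 1 (deg_ s0 n.+1 w) <= c / 2 * L.
  by rewrite degree_newborn //; exact: hN1.
have dev : Phi f 1 (deg_ s n.+1 w) - Phi f 1 (deg_ s0 n.+1 w) -
    (clock_ s w - clock_ s0 w) < c / 4 * L.
  rewrite ltNge; apply/negP => h; apply: (hN2 _ n2 _ ps0); exists s => //.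
  have -> : 2 * ln n.+2%:R = 8 / c * (c / 4 * L).
    by rewrite /L; field; rewrite gt_eqF.
  by rewrite ler_pM2l // divr_gt0.
apply/ltnW/(Phi1_lt f_gt0).
by have := hC' s; lra.
Qed.

End light_tail.

(** * Heavy tails: no persistent hub *)

Lemma harmonic_sum_le (R : realType) n :
  \sum_(1 <= i < n.+2) i%:R^-1 <= 1 + ln n.+1%:R :> R.
Proof.
elim: n => [|n IH]; first by rewrite big_nat1 invr1 ln1 addr0.
rewrite big_nat_recr //=; apply: (le_trans (lerD IH (lexx _))).
rewrite -addrA lerD2l.
have n0 : 0 < n.+2%:R :> R by [].
have n1 : 0 < n.+1%:R :> R by [].
have i1 : n.+2%:R^-1 < 1 :> R by rewrite invf_lt1 // ltr1n.
have -> : n.+1%:R = n.+2%:R * (1 - n.+2%:R^-1) :> R.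
  by rewrite mulrBr mulr1 divff ?gt_eqF // -[n.+2%:R]natr1 addrK.
rewrite lnM ?posrE ?subr_gt0 //.
rewrite -addrA gerDl -[X in _ + X]opprK subr_le0.
by rewrite le_ln1Dx // ltrN2.
Qed.

Lemma pow_le_inv (R : realType) (x : R) N : 0 <= x <= 1 ->
  (1 - x) ^+ N * (1 + N%:R * x) <= 1.
Proof.
move=> /andP[x0 x1]; elim: N => [|N IH]; first by rewrite expr0 mul0r addr0 mul1r.
apply: le_trans IH; rewrite exprSr -mulrA ler_wpM2l ?exprn_ge0 ?subr_ge0 //.
by rewrite -natr1; have := ler0n R N; nra.
Qed.

Lemma muln_exp2_le_sub N j : (N <= j)%N -> (N * 2 ^ j <= 4 ^ j - j)%N.
Proof.
move=> Nj; have je := ltn_expl j (ltnSn 1).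
rewrite -[4%N]/(2 * 2)%N expnMn; move: (2 ^ j)%N je => e je.
have h1 : (N * e <= j * e)%N by rewrite leq_mul2r Nj orbT.
have h2 : (j * e + e <= e * e)%N by rewrite addnC -mulSn leq_mul2r je orbT.
lia.
Qed.

Section heavy_tail.
Context d (T : measurableType d) (R : realType) (P : probability T R).
Variables (f : nat -> R) (m : nat -> {RV P >-> nat})
  (t : nat -> nat -> {RV P >-> nat}).
Hypothesis f_gt0 : forall i, 0 < f i.
Hypothesis f_ndecr : forall i j, (i <= j)%N -> f i <= f j.
Hypothesis Phi2_finite : (Phi_infty f 2 < +oo)%E.
Hypothesis m_pos : forall i, (0 < i)%N -> {ae P, forall w, (0 < m i w)%N}.
Hypothesis G_process : attachment_process m t f.
Hypothesis m_iid : iid m.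
Hypothesis m_mean : ('E_P[fun w => (m 1%N w)%:R] < +oo)%E.

Local Notation ms w := (fun i => m i w).
Local Notation ts w := (fun i k => t i k w).
Local Notation deg_ s v w := (degree (ms w) (ts w) s v).
Local Notation clock_ s w := (clock f (ms w) (ts w) s).
Local Notation stage_ s w := (stage (ms w) s).

(** Up to the factor [f 0], an upper bound for the clock at the birth of [v_n]. *)
Definition edge_load n w : R := \sum_(1 <= i < n.+1) (m i w)%:R / i%:R.

Lemma same_law i (B : set nat) : (0 < i)%N -> P (m i @^-1` B) = P (m 1%N @^-1` B).
Proof.
by move=> i0; have := congr1 (fun mu => mu B) (m_iid.2 i 1%N i0 (ltn0Sn 0)).
Qed.

Lemma m_measurable i : measurable_fun setT (fun w => (m i w)%:R : R).
Proof.
move=> _ B _; rewrite setTI.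
rewrite (_ : _ @^-1` B = m i @^-1` [set k | B k%:R]) //; exact: nat_event.
Qed.

Lemma mean_m i : (0 < i)%N ->
  (\int[P]_w ((m i w)%:R%:E) = 'E_P[fun w => (m 1%N w)%:R])%E.
Proof.
move=> i0; rewrite unlock.
have meas : measurable_fun [set: nat] (fun k : nat => (k%:R%:E : \bar R)).
  by [].
have law j := @ge0_integral_distribution _ _ _ _ _ P (m j) _ meas
  (fun k => ler0n _ k : (0 <= k%:R%:E)%E).
rewrite -[LHS](law i) -[RHS](law 1%N); apply: eq_measure_integral => B _ _.
exact: same_law.
Qed.

Lemma mean_edge_load n :
  (\int[P]_w (edge_load n.+1 w)%:E <=
   (fine 'E_P[fun w => (m 1%N w)%:R] * (1 + ln n.+1%:R))%:E)%E.
Proof.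
have E0 : (0 <= 'E_P[fun w => (m 1%N w)%:R])%E by exact: expectation_ge0.
have fin : 'E_P[fun w => (m 1%N w)%:R]%E \is a fin_num by rewrite ge0_fin_numE.
have mm i : measurable_fun setT (fun w => ((m i w)%:R%:E : \bar R)).
  by apply/measurable_EFinP; exact: m_measurable.
have m0 i w : (0 <= (m i w)%:R%:E :> \bar R)%E by rewrite lee_fin.
have -> : (fun w => (edge_load n.+1 w)%:E) =
    (fun w => \sum_(1 <= i < n.+2) (i%:R^-1)%:E * (m i w)%:R%:E)%E.
  apply/funext => w; rewrite /edge_load -sumEFin; apply: eq_bigr => i _.
  by rewrite -EFinM mulrC.
rewrite ge0_integral_sum //; last first.
  by move=> i; exact: measurable_funeM.
rewrite [leLHS](_ : _ = \sum_(1 <= i < n.+2)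
    ((i%:R^-1) * fine 'E_P[fun w => (m 1%N w)%:R])%:E)%E.
  rewrite sumEFin -mulr_suml lee_fin mulrC ler_wpM2l ?fine_ge0 //.
  exact: harmonic_sum_le.
rewrite big_nat [RHS]big_nat; apply: eq_bigr => i /andP[i0 _].
by rewrite ge0_integralZl_EFin ?invr_ge0 // mean_m // EFinM fineK.
Qed.

Lemma edge_load_ge0 n w : 0 <= edge_load n w.
Proof. by apply: sumr_ge0 => i _; rewrite divr_ge0. Qed.

Lemma edge_load_measurable n : measurable_fun setT (edge_load n).
Proof.
apply: measurable_sum => i; apply: measurable_funM => //; exact: m_measurable.
Qed.

Lemma edge_load_event n a : measurable [set w | a < edge_load n w].
Proof.
rewrite (_ : mkset _ = edge_load n @^-1` `]a, +oo[).
  by rewrite -[X in measurable X]setTI; exact: edge_load_measurable.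
by apply/seteqP; split => w /=; rewrite in_itv /= andbT.
Qed.

Lemma edge_load_tail n a : 0 < a ->
  (P [set w | (a < edge_load n.+1 w)%R] <=
   (fine 'E_P[fun w => (m 1%N w)%:R] * (1 + ln n.+1%:R) / a)%:E)%E.
Proof.
move=> a0; set B := [set w | _].
have mB : measurable B by exact: edge_load_event.
have mE A : measurable_fun A (EFin \o edge_load n.+1).
  apply: (measurable_funS measurableT) => //.
  by apply/measurable_EFinP; exact: edge_load_measurable.
have [b Eb] : exists b : R, P B = b%:E.
  by exists (fine (P B)); rewrite fineK // fin_num_measure.
suff : (a%:E * P B <= (fine 'E_P[fun w => (m 1%N w)%:R] * (1 + ln n.+1%:R))%:E)%E.
  by rewrite Eb !lee_fin ler_pdivlMr // mulrC.
apply: le_trans (mean_edge_load n).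
apply: (@le_trans _ _ (\int[P]_(w in B) (edge_load n.+1 w)%:E)%E).
  rewrite -integral_cst //; apply: ge0_le_integral => //.
  - by move=> w _; rewrite lee_fin ltW.
  - by move=> w Bw; rewrite lee_fin ltW.
apply: ge0_subset_integral => //.
by move=> w _; rewrite lee_fin edge_load_ge0.
Qed.

Lemma no_large_newborn (B : set nat) (x : R) j N : 0 <= x ->
  (x%:E <= P (m 1%N @^-1` B))%E ->
  (P (\bigcap_(i in [set` iota j.+1 N]) m i @^-1` (~` B)) <=
     ((1 + N%:R * x)^-1)%:E)%E.
Proof.
move=> x0 xB.
have mB i : measurable (m i @^-1` B) by exact: nat_event.
have [b Eb] : exists b : R, P (m 1%N @^-1` B) = b%:E.
  by exists (fine (P (m 1%N @^-1` B))); rewrite fineK // fin_num_measure.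
have b1 : b <= 1 by rewrite -lee_fin -Eb probability_le1.
rewrite m_iid.1 ?iota_uniq //; last first.
  by apply/allP => i; rewrite mem_iota => /andP[/(leq_trans (ltn0Sn j))].
have PC i : i \in iota j.+1 N -> P (m i @^-1` (~` B)) = (1 - b)%:E.
  rewrite mem_iota => /andP[ij _]; rewrite preimage_setC probability_setC; last exact: mB.
  by rewrite EFinB -Eb; congr (1 - _)%E; apply: same_law; exact: leq_trans ij.
rewrite (eq_big_seq _ PC) big_const_seq count_predT size_iota.
have -> : iter N (mule (1 - b)%:E) 1%E = ((1 - b) ^+ N)%:E.
  by elim: (N) => //= n ->; rewrite -EFinM exprS.
rewrite lee_fin.
move: xB; rewrite Eb lee_fin => xb.
have d0 : 0 < 1 + N%:R * x by rewrite ltr_pwDl // mulr_ge0.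
rewrite -[leRHS]mul1r ler_pdivlMr //.
apply: le_trans (pow_le_inv N (_ : 0 <= x <= 1)); last by rewrite x0 (le_trans xb).
by rewrite (ler_wpM2r (ltW d0)) // lerXn2r ?nnegrE; lra.
Qed.

Variables (D z0 theta : R).
Hypothesis D_gt0 : 0 < D.
Hypothesis theta_gt0 : 0 < theta.
Hypothesis theta_lt1 : theta < 1.
Hypothesis tail : forall z, z0 <= z ->
  ((expR (- D * z `^ theta))%:E <= P [set w | (z < Phi f 1 (m 1%N w))%R])%E.

(** At this level the tail is at least [2 ^- j]. *)
Let level (j : nat) : R := (j%:R * (ln 2 / D)) `^ theta^-1.

Let rate_gt0 : 0 < ln 2 / D.
Proof. by rewrite divr_gt0 // ln_gt0 // ltr1n. Qed.

Let level_large (M : R) : 0 <= M ->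
  exists J : nat, forall j, (J <= j)%N -> M * j%:R <= level j.
Proof.
move=> M0; have q1 : 1 < theta^-1 by rewrite invf_gt1.
have [y0 _ hy0] := powR_superlinear q1 (divr_ge0 M0 (ltW rate_gt0)).
exists (Num.truncn (y0 / (ln 2 / D))).+1 => j Jj.
have -> : M * j%:R = M / (ln 2 / D) * (j%:R * (ln 2 / D)).
  by rewrite mulrCA divfK ?gt_eqF // mulrC.
apply: hy0; rewrite -ler_pdivrMr //.
by apply: le_trans (ltW (truncnS_gt _)) _; rewrite ler_nat.
Qed.

Let tail_level : exists J : nat, forall j, (J <= j)%N ->
  ((2%:R ^- j)%:E <= P [set w | (level j < Phi f 1 (m 1%N w))%R])%E.
Proof.
have [J hJ] := level_large ler01.
exists (maxn J (Num.truncn z0).+1) => j; rewrite geq_max => /andP[Jj zj].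
have -> : 2 ^- j = expR (- D * level j `^ theta).
  rewrite /level -powRrM mulVf ?gt_eqF // powRr1; last first.
    by rewrite mulr_ge0 // ltW.
  have -> : - D * (j%:R * (ln 2 / D)) = - (ln 2 * j%:R).
    by field; rewrite gt_eqF.
  by rewrite expRN expRM_natr lnK // posrE.
apply: tail; apply: le_trans (hJ j Jj); rewrite mul1r.
by apply: le_trans (ltW (truncnS_gt _)) _; rewrite ler_nat.
Qed.

Let bad j : set T :=
  [set w | f 0 * level j / 2 < edge_load (4 ^ j) w] `|`
  \bigcap_(i in [set` iota j.+1 (4 ^ j - j)])
     m i @^-1` (~` [set x | level j < Phi f 1 x]).

Let bad_measurable j : measurable (bad j).
Proof.
apply: measurableU; first exact: edge_load_event.
by apply: bigcap_measurableType => i _; exact: nat_event.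
Qed.

(** Around [4 ^ j] vertices have a chance of at least [2 ^- j] each to be born
    above [level j], which grows faster than [j], the order of the mean load. *)
Let bad_small (N : nat) : exists J : nat, forall j, (J <= j)%N ->
  (P (bad j) <= (2 / N.+1%:R)%:E)%E.
Proof.
have f00 := f_gt0 0.
have E0 : (0 <= 'E_P[fun w => (m 1%N w)%:R])%E by exact: expectation_ge0.
have := fine_ge0 E0; set mu := fine _ => mu0.
pose M := 6 * mu * N.+1%:R / f 0 + 1.
have M0 : 0 <= M by rewrite addr_ge0 // divr_ge0 ?mulr_ge0 // ltW.
have [J1 hJ1] := level_large M0; have [J2 hJ2] := tail_level.
exists (maxn J1 (maxn J2 (maxn N 1))) => j.
rewrite !geq_max => /and4P[j1 j2 jN j0].
have zM := hJ1 j j1; have j1' : 1 <= j%:R :> R by rewrite ler1n.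
have N0 : 0 < N.+1%:R :> R by [].
have lev0 : 0 < level j.
  by apply: lt_le_trans zM; rewrite mulr_gt0 ?ltr_wpDl ?divr_ge0 ?mulr_ge0 // ?ltW ?ltr0n.
have a0 : 0 < f 0 * level j / 2 by rewrite divr_gt0 ?mulr_gt0.
apply: le_trans (measureU2 _ _ _) _; first exact: edge_load_event.
  by apply: bigcap_measurableType => i _; exact: nat_event.
have -> : 2 / N.+1%:R = N.+1%:R^-1 + N.+1%:R^-1 :> R.
  by rewrite -mulr2n mulr_natl.
rewrite EFinD; apply: leeD.
  have E4 : (4 ^ j)%N = (4 ^ j).-1.+1 by rewrite prednK // expn_gt0.
  rewrite E4; apply: (le_trans (edge_load_tail _ a0)); rewrite -E4 -/mu lee_fin.
  have ln4 : ln (4 ^ j)%:R <= 2 * j%:R :> R.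
    rewrite natrX lnXn // -[leLHS]mulr_natr ler_wpM2r //.
    have -> : (4 : R) = 2 ^+ 2 by rewrite -natrX.
    rewrite lnXn //; have : ln (1 + 1) <= 1 :> R by apply: le_ln1Dx; lra.
    by rewrite mulr2n; lra.
  rewrite ler_pdivrMr // [leRHS]mulrC ler_pdivlMr //.
  have fM : f 0 * M = 6 * mu * N.+1%:R + f 0 by rewrite /M; field; rewrite gt_eqF.
  apply: (@le_trans _ _ (f 0 * (M * j%:R) / 2)); last first.
    by rewrite ler_pM2r ?invr_gt0 // ler_pM2l.
  rewrite mulrA fM; apply: (@le_trans _ _ (mu * (3 * j%:R) * N.+1%:R)).
    by apply: ler_wpM2r => //; apply: ler_wpM2l => //; lra.
  by move: (mu) (j%:R) (N.+1%:R) mu0 j1' N0 => a b c ? ? ?; nra.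
have x0 : 0 <= 2 ^- j :> R by rewrite invr_ge0 exprn_ge0.
apply: (le_trans (no_large_newborn _ _ x0 (hJ2 j j2))); rewrite lee_fin.
have two0 : 0 < 2 ^+ j :> R by rewrite exprn_gt0.
have d0 : 0 < 1 + (4 ^ j - j)%:R * 2 ^- j :> R by rewrite ltr_pwDl // mulr_ge0.
rewrite lef_pV2 ?posrE //.
rewrite -natr1 addrC lerD2l ler_pdivlMr // -natrX -natrM ler_nat.
exact: muln_exp2_le_sub.
Qed.

Lemma often_good :
  {ae P, forall w, forall J, exists2 j, (J <= j)%N & ~ bad j w}.
Proof.
apply: ae_foralln => J.
pose B := \bigcap_(j in [set j | (J <= j)%N]) bad j.
have mB : measurable B by exact: bigcap_measurableType.
exists B; split => //; last first.
  by move=> w /= h j Jj; apply: contrapT => nb; apply: h; exists j.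
have [p Ep] : exists p : R, P B = p%:E.
  by exists (fine (P B)); rewrite fineK // fin_num_measure.
have p0 : 0 <= p by rewrite -lee_fin -Ep measure_ge0.
apply: (etrans Ep); rewrite (@eq0_of_le_div _ p 2) // => n.
have [J1 hJ1] := bad_small n; have := hJ1 (maxn J J1) (leq_maxr _ _).
have : (P B <= P (bad (maxn J J1)))%E.
  by apply: le_measure; rewrite ?inE //; apply: bigcap_inf; exact: leq_maxl.
rewrite Ep => le1 le2; have := le_trans le1 le2; rewrite lee_fin.
rewrite ler_pdivlMr //; apply: le_trans; rewrite ler_wpM2l // ler_nat.
exact: leqnSn.
Qed.

(** The degree of a fixed vertex keeps up with the clock only up to a constant,
    and infinitely many vertices are born far ahead of the clock. *)
Lemma heavy_tail_no_hub :
  {ae P, forall w, ~ persistent_hub (fun n => random_graph m t n w)}.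
Proof.
have f00 := f_gt0 0.
have hlam : - (f 0 / 2) <= 1 by apply: (@le_trans _ _ 0) => //; lra.
have ae1 : {ae P, forall w, forall v, exists C, forall s, (v <= stage_ s w)%N ->
    1 * (Phi f 1 (deg_ s v w) - clock_ s w) <= C}.
  by apply: ae_foralln => v; exact: fluctuation_bounded hlam.
have ae2 := target_le_ae f_gt0 f_ndecr m_pos G_process.
apply: filterS (filterI (filterI ae1 (m_pos_ae m_pos)) (filterI ae2 often_good)).
move=> w [[bounded mpos] [tle good]] [n0 [v hub]].
have [C hC] := bounded v.
have [J hJ] := level_large (ler0n _ 2).
have [j] := good (maxn J (maxn (Num.truncn C).+1 (maxn n0 v))).
rewrite !geq_max => /and4P[jJ jC jn jv] /not_orP[small /= large].
have [i [hi mi]] : exists i, (j < i <= 4 ^ j)%N /\ level j < Phi f 1 (m i w).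
  apply: contrapT => no; apply: large => i /=; rewrite mem_iota => hi h.
  by apply: no; exists i; split => //; have := ltn_expl j (isT : (1 < 4)%N); lia.
have [s ps] := exists_pos mpos i.
have st : stage_ s w = i by rewrite /stage ps.
have [/andP[ji i4] i0] : (j < i <= 4 ^ j)%N /\ (0 < i)%N by split; lia.
have Cj : C < j%:R.
  by apply: lt_le_trans (truncnS_gt _) _; rewrite ler_nat.
have clock_s : clock_ s w <= level j / 2.
  apply: (le_trans (clock_le_start (ts w) f_gt0 f_ndecr mpos ps)).
  move: small => /negP; rewrite -leNgt => small.
  rewrite ler_pdivrMl // mulrA; apply: le_trans small.
  rewrite /edge_load [leRHS](big_cat_nat (n := i.+1)) //=.
  by rewrite lerDl; apply: sumr_ge0 => k _; rewrite divr_ge0.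
have deg_v : Phi f 1 (deg_ s v w) < Phi f 1 (m i w).
  apply: lt_trans mi; have vs : (v <= stage_ s w)%N by rewrite st; lia.
  by have := hC s vs; have := hJ j jJ; lra.
have [|_ /(_ i)] := hub i; first by lia.
rewrite /random_graph vertices_graph // mem_iota /= add0n ltnS leqnn.
move=> /(_ isT); rewrite !(deg_graph (ts w) mpos _ ps).
have -> : deg_ s i w = m i w by case: i i0 ps {st hi mi ji i4 deg_v} => // i _; exact: degree_newborn.
by have := Phi1_lt f_gt0 deg_v; rewrite ltnNge => /negP.
Qed.

End heavy_tail.
Theorem theorem4p6 (R : realType) (d : measure_display) (T : measurableType d)
    (P : probability T R) (f : nat -> R)
    (m : nat -> {RV P >-> nat}) (t : nat -> nat -> {RV P >-> nat})
    (hf : attachment_function f)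
    (f_nondecreasing : forall i j, (i <= j)%N -> f i <= f j)
    (Phi2_finite : (Phi_infty f 2 < +oo)%E)
    (m_iid : iid m)
    (m_pos : forall i, (0 < i)%N -> {ae P, forall w, (0 < m i w)%N})
    (G_process : attachment_process m t f) :
  ((exists2 Cf : R, 0 < Cf & forall i, f i <= Cf * i.+1%:R) ->
   (exists D z0 theta : R, [/\ 0 < D, 0 < z0, 1 < theta &
      forall z, z0 <= z ->
        (P [set w | (z < Phi f 1 (m 1%N w))%R]
           <= (expR (- D * z `^ theta))%:E)%E]) ->
   {ae P, forall w, persistent_hub (fun n => random_graph m t n w)})
  /\
  (('E_P[fun w => (m 1%N w)%:R] < +oo)%E ->
   (exists D' z0' theta' : R, [/\ 0 < D', 0 < z0', 0 < theta' < 1 &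
      forall z, z0' <= z ->
        ((expR (- D' * z `^ theta'))%:E
           <= P [set w | (z < Phi f 1 (m 1%N w))%R])%E]) ->
   {ae P, forall w, ~ persistent_hub (fun n => random_graph m t n w)}).
Proof.
have f_gt0 : forall i, 0 < f i by case: hf.
split.
  move=> [Cf Cf0 fC] [D [z0 [theta [D0 _ theta1 tail]]]].
  have untied : {ae P, forall w, forall u v, u != v ->
      ~ tied_unboundedly m t u v w}.
    apply: ae_foralln => u; apply: ae_foralln => v.
    have [->|uv] := eqVneq u v; first exact: aeW.
    exists (tied_unboundedly m t u v); split.
    - exact: tied_unboundedly_measurable.
    - exact: (tied_unboundedly_null f_gt0 f_nondecreasing Phi2_finite m_pos
                G_process uv).
    - by move=> w /= /not_implyP[_ /contrapT].
  have late := light_tail_late f_gt0 f_nondecreasing Phi2_finite m_pos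
    G_process m_iid.2 Cf0 fC D0 theta1 tail.
  apply: filterS (filterI untied (filterI (m_pos_ae m_pos) late)).
  by move=> w [ties [mpos [N hN]]]; exact: persistent_hub_of_late ties mpos hN.
move=> mean [D [z0 [theta [D0 _ /andP[theta0 theta1] tail]]]].
exact: (heavy_tail_no_hub f_gt0 f_nondecreasing Phi2_finite m_pos G_process
  m_iid mean D0 theta0 theta1 tail).
Qed.
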